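(* Let $\mathcal V$ be an $N=2$ superconformal raviolo vertex algebra satisfying the BPS bound and suppose $\mu_a$ generate a $\mathfrak g$ Higgs branch flavor symmetry of $\mathcal V$, where $\mu_a$ is the superpartner of the Higgs branch primary operator $M_a$. Then the Higgs branch $\mathcal M_H[\mathcal V]$ admits a Hamiltonian $\mathfrak g$ action with comoment map $\mathfrak g\to A_H[\mathcal V]=\mathcal O(\mathcal M_H[\mathcal V])$, $T_a\mapsto M_a$. (That is, $T_a\mapsto M_a$ is compatible with the brackets, and the $\mathfrak g$ action on $A_H[\mathcal V]$ given by $O\mapsto\mu_{a,(0)}O$ equals $O\mapsto\{M_a,O\}$.)
   Context: **Raviolo vertex algebras.** $\mathcal K=\mathbb C\langle\!\langle z\rangle\!\rangle$ is the graded-commutative algebra with degree $0$ part $\mathbb C[[z]]$ and degree $1$ part with basis $\Omega^m_z$ ($m\ge0$), where $z^n\Omega^m_z=\Omega^{m-n}_z$ if $n\le m$ and $0$ otherwise, and products of two degree $1$ elements vanish; $\partial_zz^n=nz^{n-1}$, $\partial_z\Omega^m_z=-(m+1)\Omega^{m+1}_z$. $R\langle\!\langle z\rangle\!\rangle$ is the analogue with coefficients in $R$; $\mathcal K_{dist}$ allows infinite sums in both degrees. $\mathcal K_{z,w,z-w}$ is the graded-commutative $\mathbb C[[z,w]]$-algebra generated by degree $1$ elements $\Omega^m_x$ ($x\in\{z,w,z-w\}$, $m\ge0$) with $x^n\Omega^m_x=\Omega^{m-n}_x$ ($n\le m$), $=0$ ($n>m$), $\Omega^m_x\Omega^n_x=0$,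 and $\Omega^0_{z-w}\Omega^0_z+\Omega^0_w\Omega^0_{z-w}+\Omega^0_z\Omega^0_w=0$ together with all relations obtained from the latter by acting with $z,w,\partial_z,\partial_w$. It maps to $\mathbb C\langle\!\langle z\rangle\!\rangle\langle\!\langle w\rangle\!\rangle$ by $\Omega^m_{z-w}\mapsto\sum_{n\ge0}\binom{m+n}{n}w^n\Omega^{m+n}_z$ and to $\mathbb C\langle\!\langle w\rangle\!\rangle\langle\!\langle z\rangle\!\rangle$ by $\Omega^m_{z-w}\mapsto(-1)^m\sum_{n\ge0}\binom{m+n}{n}z^n\Omega^{m+n}_w$. A raviolo vertex algebra with spin grading is a vector space $\mathcal V=\bigoplus\mathcal V^{r,(j)}$ graded by $R$-charge $r$ and spin $j$, with a $\mathbb Z/2$ parity $|\cdot|$ governing all Koszul signs (even = bosonic, odd = fermionic; the total cohomological plus super parity), a vacuum $|0\rangle$ of bidegree $(0,0)$, an even translation operator $\partial$ of bidegree $(0,1)$ with $\partial|0\rangle=0$, and a linear bidegree-$(0,0)$, parity-preserving map $O\mapsto O(z)=Y(O,z)=\sum_{m<0}z^{-m-1}O_{(m)}+\sum_{m\ge0}\Omega^m_zO_{(m)}$, $O_{(m)}\in\mathrm{End}(\mathcal V)$, where $z$ has spin $-1$, $\Omega^m_z$ has spin $m+1$, $\Omega^m_z$ is odd of $R$-charge $1$ (so for $O$ of $R$-charge $r$, $O_{(m)}$ has $R$-charge $r$ and parity $|O|$ if $m<0$, and $R$-charge $r-1$ and parity $|O|+1$ if $m\ge0$; $O_{(m)}$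 raises spin by $j-m-1$), such that: for all $O,v$, $O_{(m)}v=0$ for $m\gg0$; $Y(|0\rangle,z)=\mathrm{id}$, $O(z)|0\rangle\in\mathcal V[[z]]$ with value $O$ at $z=0$; $[\partial,O(z)]=\partial_zO(z)$; and locality: for all $O_1,O_2,v\in\mathcal V$, $\varphi\in\mathcal V^\vee$, the matrix elements $\langle\varphi,O_1(z)O_2(w)v\rangle$ and $(-1)^{|O_1||O_2|}\langle\varphi,O_2(w)O_1(z)v\rangle$ are the expansions of one element of $\mathcal K_{z,w,z-w}$, in which the coefficient of $\Omega^l_{z-w}$ vanishes for $l\gg0$. One may also work linearly over a graded-commutative $\mathbb C$-algebra $\mathsf S$ (of spin $0$). ''Operator'' means element of $\mathcal V$. The OPE notation $O_1(z)O_2(w)\sim\sum_{m\ge0}\Omega^m_{z-w}A_m(w)$ means $O_{1,(m)}O_2=A_m$ for all $m\ge0$; the OPE is regular ($\sim0$) if all vanish. The normally-ordered product is $:\!O_1O_2\!:\;=O_{1,(-1)}O_2$. **$N=2$ superconformal structure** (central charge $\xi$, an odd degree $1$ element of $\mathsf S$, possibly $0$): fermionic operators $\Gamma$ ($R$-charge 1, spin 2), $\sigma$ ($R$-charge 1, spin 1) and bosonic $Q^\pm$ ($R$-charge 1, spin $\frac32$) with $\Gamma_{(0)}=\partial$, $\Gamma_{(1)}$ = spin, and $\Gamma\Gamma\sim\Omega^3_{z-w}\xi/2+2\Omega^1_{z-w}\Gamma+\Omega^0_{z-w}\partial\Gamma$, $\sigma\sigma\sim\Omega^1_{z-w}\xi/3$,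 $\Gamma\sigma\sim\Omega^1_{z-w}\sigma+\Omega^0_{z-w}\partial\sigma$, $\Gamma Q^\pm\sim\frac32\Omega^1_{z-w}Q^\pm+\Omega^0_{z-w}\partial Q^\pm$, $\sigma Q^\pm\sim\pm\Omega^0_{z-w}Q^\pm$, $Q^\pm Q^\pm\sim0$, $Q^\pm Q^\mp\sim\Omega^2_{z-w}(-\xi/3)\mp\Omega^1_{z-w}\sigma+\Omega^0_{z-w}(-\Gamma\mp\frac12\partial\sigma)$ (first factor at $z$, second and right side at $w$). $\mathcal V$ is also graded by $S$-charge, the eigenvalue of $\sigma_{(0)}$; $\mathcal V^{r,(j),q}$ is the subspace of $R$-charge $r$, spin $j$, $S$-charge $q$. $\mathcal V$ satisfies the BPS bound if $\mathcal V^{r,(j),q}=0$ whenever $j<|q|/2$. **Higgs branch primaries.** $O$ is a raviolo Virasoro primary of spin $j$ if $\Gamma(z)O(w)\sim j\Omega^1_{z-w}O(w)+\Omega^0_{z-w}\partial O(w)$ and a current algebra primary of $S$-charge $q$ if $\sigma(z)O(w)\sim q\Omega^0_{z-w}O(w)$. An $O$ that is both is a Higgs branch primary operator if $Q^+(z)O(w)\sim0$ and $Q^-(z)O(w)\sim\Omega^0_{z-w}\Psi_O(w)$, where the superpartner $\Psi_O=Q^-_{(0)}O$ is a Virasoro primary of spin $j+\frac12$ and current algebra primary of $S$-charge $q-1$ (of opposite parity to $O$, same $R$-charge). **Higgs branch.** When the BPS bound holds, the span of Higgs branch primaries is a graded-commutative associative algebra $A_H[\mathcal V]$ under the normally-ordered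 product, viewed as the ring of functions on an affine (super) scheme, the Higgs branch $\mathcal M_H[\mathcal V]$. It carries the Poisson bracket $\{O_1,O_2\}=\frac12(\Psi_{O_1,(0)}O_2-(-1)^{|O_1||O_2|}\Psi_{O_2,(0)}O_1)$. **Flavor symmetry.** Let $\mathfrak g$ be a Lie algebra with basis $T_a$, $[T_a,T_b]=f^c_{ab}T_c$. A Hamiltonian $\mathfrak g$ symmetry is given by fermionic operators $\mu_a$ of $R$-charge $1$, spin $1$, $S$-charge $0$ with $\mu_a(z)\mu_b(w)\sim\Omega^1_{z-w}K_{ab}+\Omega^0_{z-w}f^c_{ab}\mu_c(w)$, which are Virasoro primaries of spin 1; $K_{ab}\in\mathsf S$ is the level. It is a Higgs branch flavor symmetry if each $\mu_a$ is the superpartner of a Higgs branch primary $M_a$ (of $R$-charge 1, spin $\frac12$, $S$-charge 1), the assignment $T_a\mapsto M_a$ being linear: $Q^+(z)M_a(w)\sim0$, $Q^-(z)M_a(w)\sim\Omega^0_{z-w}\mu_a(w)$, $Q^+(z)\mu_a(w)\sim\Omega^1_{z-w}M_a(w)+\Omega^0_{z-w}\partial M_a(w)$, $Q^-(z)\mu_a(w)\sim0$.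
   Formalization: The raviolo vertex algebra is also assumed to satisfy the commutator (Jacobi) identity for two non-negative modes; the listed axioms do not imply it, since locality is vacuous in cohomological degree 2, and without it the claim fails. *)

(* Defs.v *)
From HB Require Import structures.
From mathcomp Require Import all_boot all_order all_algebra.
From mathcomp Require Import classical_sets fsbigop reals.
From mathcomp Require Import complex.

Set Implicit Arguments.
Unset Strict Implicit.
Unset Printing Implicit Defensive.

Import Order.TTheory GRing.Theory Num.Theory.

Local Open Scope ring_scope.
Local Open Scope complex_scope.

(* A direct sum decomposition V = \bigoplus_i V_i, given by its projections. *)
Record grading (F : fieldType) (I : eqType) (V : lmodType F) := Grading {
  gproj :> I -> {linear V -> V};
  gproj_orth : forall i j v, gproj i (gproj j v) = if i == j then gproj j v else 0;
  gproj_sum : forall v, exists2 s : seq I, uniq s & v = \sum_(i <- s) gproj i v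
}.

Definition homog (F : fieldType) (I : eqType) (V : lmodType F)
  (G : grading I V) (i : I) (v : V) : Prop := G i v = v.

(* In a double series f : int -> int -> C, the entry f p q is the coefficient
   of e_p(z) e_q(w), in this order, where e_m(x) = x^(-m-1) for m < 0 and
   e_m(x) = Omega^m_x for m >= 0, so that O(z) = \sum_m e_m(z) O_(m). Both
   C<<z>><<w>> and C<<w>><<z>> are spaces of such series. *)
Definition odd_mode (m : int) : bool := 0 <= m.

(* e_i e_j = e_(i+j+1) if this holds, and e_i e_j = 0 otherwise. *)
Definition mode_mul_neq0 (i j : int) : bool :=
  ~~ (odd_mode i && odd_mode j) &&
  ((odd_mode i || odd_mode j) ==> odd_mode (i + j + 1)).

Section DoubleSeries.
Variable R : realType.
Local Notation C := R[i].

Definition dser := int -> int -> C.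

(* The graded-commutative product; inside C<<z>><<w>>, and inside C<<w>><<z>>,
   only finitely many terms contribute to each coefficient. *)
Definition dmul (f g : dser) : dser := fun p q =>
  \sum_(ij \in [set: int * int])
    let i := ij.1 in let j := ij.2 in
    let i' := p - 1 - i in let j' := q - 1 - j in
    if mode_mul_neq0 i i' && mode_mul_neq0 j j'
    then (-1) ^+ (odd_mode j && odd_mode i') * (f i j * g i' j') else 0.

(* The power series \sum_(k, l) a k l z^k w^l. *)
Definition pser (a : nat -> nat -> C) : dser := fun p q =>
  match p, q with Negz k, Negz l => a k l | _, _ => 0 end.

Definition dser1 : dser := pser (fun k l => ((k == 0) && (l == 0))%:R).

Inductive point := Pz | Pw | Pzw.

(* The images of the generator Omega^m_x, x = z, w, z - w. *)
Definition gen_zw (x : point) (m : nat) : dser := fun p q =>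
  match x with
  | Pz => ((p == m%:Z) && (q == -1))%:R
  | Pw => ((p == -1) && (q == m%:Z))%:R
  | Pzw => match p, q with
           | Posz k, Negz n => if k == (m + n)%N then 'C(m + n, n)%:R else 0
           | _, _ => 0
           end
  end.

Definition gen_wz (x : point) (m : nat) : dser := fun p q =>
  match x with
  | Pz => ((p == m%:Z) && (q == -1))%:R
  | Pw => ((p == -1) && (q == m%:Z))%:R
  | Pzw => match p, q with
           | Negz n, Posz k =>
             if k == (m + n)%N then (-1) ^+ m * 'C(m + n, n)%:R else 0
           | _, _ => 0
           end
  end.

(* Representatives of the elements of K_{z,w,z-w}: finite C[[z,w]]-linear
   combinations of words in the generators. The two expansions below are
   C[[z,w]]-algebra maps respecting the defining relations of K_{z,w,z-w}, so
   the pairs of expansions of elements of K_{z,w,z-w} are those of such words.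
   Since the combinations are finite, Omega^l_{z-w} does not occur for l >> 0. *)
Definition Kzw := seq ((nat -> nat -> C) * seq (point * nat)).

Definition expand (gen : point -> nat -> dser) (E : Kzw) : dser := fun p q =>
  \sum_(t <- E)
    dmul (pser t.1) (foldr (fun g f => dmul (gen g.1 g.2) f) dser1 t.2) p q.

Definition expand_zw := expand gen_zw.
Definition expand_wz := expand gen_wz.

End DoubleSeries.

Section Raviolo.
Variable R : realType.
Local Notation C := R[i].

(* Charges are real numbers: integral and half-integral gradings are the ones
   whose other components vanish. The sign rule is governed by the parity only
   (true = odd = fermionic). *)
Record graded_comm_alg (S : algType C) := GradedCommAlg {
  s_rch : grading R S;
  s_par : grading bool S;
  s_rch_par : forall r p a, s_rch r (s_par p a) = s_par p (s_rch r a);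
  s_rch1 : homog s_rch 0 1;
  s_par1 : homog s_par false 1;
  s_rchM : forall r r' a b,
    homog s_rch r a -> homog s_rch r' b -> homog s_rch (r + r') (a * b);
  s_parM : forall p p' a b,
    homog s_par p a -> homog s_par p' b -> homog s_par (p (+) p') (a * b);
  s_gcomm : forall (p p' : bool) a b, homog s_par p a -> homog s_par p' b ->
    a * b = (-1) ^+ (p && p') * (b * a)
}.

Record raviolo_va (S : algType C) (SG : graded_comm_alg S) (V : lmodType C) :=
RavioloVA {
  rch : grading R V;
  spin : grading R V;
  par : grading bool V;
  rch_spin : forall r j v, rch r (spin j v) = spin j (rch r v);
  rch_par : forall r p v, rch r (par p v) = par p (rch r v);
  spin_par : forall j p v, spin j (par p v) = par p (spin j v);

  sact : S -> {linear V -> V};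
  sact1 : forall v, sact 1 v = v;
  sactM : forall a b v, sact (a * b) v = sact a (sact b v);
  sact_linear : forall c a b v, sact (c *: a + b) v = c *: sact a v + sact b v;
  sact_rch : forall r r' a v,
    homog (s_rch SG) r a -> homog rch r' v -> homog rch (r + r') (sact a v);
  sact_spin : forall j a v, homog spin j v -> homog spin j (sact a v);
  sact_par : forall p p' a v,
    homog (s_par SG) p a -> homog par p' v -> homog par (p (+) p') (sact a v);

  vac : V;
  vac_rch : homog rch 0 vac;
  vac_spin : homog spin 0 vac;
  vac_par : homog par false vac;

  der : {linear V -> V};
  der_rch : forall r v, homog rch r v -> homog rch r (der v);
  der_spin : forall j v, homog spin j v -> homog spin (j + 1) (der v);
  der_par : forall p v, homog par p v -> homog par p (der v);
  der_sact : forall a v, der (sact a v) = sact a (der v);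
  der_vac : der vac = 0;

  (* mode O m = O_(m), the coefficient of e_m(z) in Y(O, z) *)
  mode : V -> int -> {linear V -> V};
  mode_linear : forall c O O' m v,
    mode (c *: O + O') m v = c *: mode O m v + mode O' m v;
  mode_sactl : forall (p : bool) a O m v, homog (s_par SG) p a ->
    mode (sact a O) m v = (-1) ^+ (p && odd_mode m) *: sact a (mode O m v);
  mode_sactr : forall (p p' : bool) a O m v,
    homog (s_par SG) p a -> homog par p' O ->
    mode O m (sact a v)
      = (-1) ^+ (p && (p' (+) odd_mode m)) *: sact a (mode O m v);
  mode_rch : forall r r' O m v, homog rch r O -> homog rch r' v ->
    homog rch (r + r' - (odd_mode m)%:R) (mode O m v);
  mode_spin : forall j j' O m v, homog spin j O -> homog spin j' v ->
    homog spin (j' + (j - m%:~R - 1)) (mode O m v);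
  mode_par : forall p p' O m v, homog par p O -> homog par p' v ->
    homog par (p (+) odd_mode m (+) p') (mode O m v);

  mode_field : forall O v, exists N : nat, forall m : nat,
    (N <= m)%N -> mode O m v = 0;
  mode_vac : forall m v, mode vac m v = if m == -1 then v else 0;
  mode_vac_ge0 : forall O (m : nat), mode O m vac = 0;
  mode_vacN1 : forall O, mode O (-1) vac = O;

  (* the derivative of e_m is -(m + 1) e_(m+1) *)
  mode_der : forall O m v,
    der (mode O m v) - mode O m (der v) = - (m%:~R *: mode O (m - 1) v);

  (* In O1(z)O2(w), moving e_q(w) to the left of O1_(p) produces the first
     sign. In (-1)^(p1 p2) O2(w)O1(z), the sign of moving e_p(z) to the left
     of O2_(q), combined with that of e_q(w) e_p(z) = +- e_p(z) e_q(w), is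
     (-1)^(p2 [p >= 0]). *)
  locality : forall (p1 p2 : bool) O1 O2 v (phi : {scalar V}),
    homog par p1 O1 -> homog par p2 O2 ->
    exists E : Kzw R,
      (forall p q : int, expand_zw E p q =
        (-1) ^+ (odd_mode q && (p1 (+) odd_mode p))
          * phi (mode O1 p (mode O2 q v))) /\
      (forall p q : int, expand_wz E p q =
        (-1) ^+ ((p1 && p2) (+) (odd_mode p && p2))
          * phi (mode O2 q (mode O1 p v)));

  (* Degree 2 part of associativity: the coefficient of Omega^m_z Omega^n_w in
     the identity expressing O1(z)O2(w) - (-1)^(p1 p2) O2(w)O1(z) as the sum
     over l of the difference of the two expansions of Omega^l_{z-w}, times
     (O1_(l) O2)(w). In degrees 0 and 1, and in ordinary vertex algebras, such
     identities follow from locality because expansions are injective. In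
     degree 2 they are not: Omega_{z-w} Omega_z expands to 0 in
     C<<z>><<w>>, and Omega_{z-w} Omega_w in C<<w>><<z>>, so that locality
     imposes nothing on the products O1_(m) O2_(n) with m, n >= 0. *)
  mode_jacobi : forall (p1 p2 : bool) O1 O2 (m n : nat) v,
    homog par p1 O1 -> homog par p2 O2 ->
    mode O1 m (mode O2 n v)
      - (-1) ^+ (~~ p1 && ~~ p2) *: mode O2 n (mode O1 m v)
    = (-1) ^+ (~~ p1) *: \sum_(l < m.+1)
        'C(m, l)%:R *: mode (mode O1 l O2) (m + n - l)%N v
}.

Section Operators.
Variables (S : algType C) (SG : graded_comm_alg S) (V : lmodType C).
Variable X : raviolo_va SG V.

(* O1(z)O2(w) ~ \sum_m Omega^m_{z-w} A_m(w), with A the list of the A_m and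
   A_m = 0 beyond its end. *)
Definition ope (O1 O2 : V) (A : seq V) : Prop :=
  forall m : nat, mode X O1 m O2 = nth 0 A m.

Definition nop (O1 O2 : V) : V := mode X O1 (-1) O2.

Definition has_charges (r j : R) (p : bool) (O : V) : Prop :=
  [/\ homog (rch X) r O, homog (spin X) j O & homog (par X) p O].

End Operators.

Record n2_superconformal (S : algType C) (SG : graded_comm_alg S)
    (V : lmodType C) (X : raviolo_va SG V) := N2Superconformal {
  xi : S;
  xi_rch : homog (s_rch SG) 1 xi;
  xi_par : homog (s_par SG) true xi;

  Gam : V;
  sig : V;
  Qp : V;
  Qm : V;
  Gam_charges : has_charges X 1 2 true Gam;
  sig_charges : has_charges X 1 1 true sig;
  Qp_charges : has_charges X 1 (3 / 2) false Qp;
  Qm_charges : has_charges X 1 (3 / 2) false Qm;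

  Gam0 : forall v, mode X Gam 0 v = der X v;
  Gam1 : forall j v, homog (spin X) j v -> mode X Gam 1 v = j%:C *: v;

  ope_GamGam : ope X Gam Gam
    [:: der X Gam; 2 *: Gam; 0; 2^-1 *: sact X xi (vac X)];
  ope_sigsig : ope X sig sig [:: 0; 3^-1 *: sact X xi (vac X)];
  ope_Gamsig : ope X Gam sig [:: der X sig; sig];
  ope_GamQp : ope X Gam Qp [:: der X Qp; (3 / 2) *: Qp];
  ope_GamQm : ope X Gam Qm [:: der X Qm; (3 / 2) *: Qm];
  ope_sigQp : ope X sig Qp [:: Qp];
  ope_sigQm : ope X sig Qm [:: - Qm];
  ope_QpQp : ope X Qp Qp [::];
  ope_QmQm : ope X Qm Qm [::];
  ope_QpQm : ope X Qp Qm
    [:: - Gam - 2^-1 *: der X sig; - sig; - (3^-1 *: sact X xi (vac X))];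
  ope_QmQp : ope X Qm Qp
    [:: - Gam + 2^-1 *: der X sig; sig; - (3^-1 *: sact X xi (vac X))];

  sch : grading R V;
  sig0 : forall q v, homog sch q v -> mode X sig 0 v = q%:C *: v
}.

Section Higgs.
Variables (S : algType C) (SG : graded_comm_alg S) (V : lmodType C).
Variables (X : raviolo_va SG V) (N : n2_superconformal X).

Definition bps_bound : Prop := forall (r j q : R) (v : V),
  homog (rch X) r v -> homog (spin X) j v -> homog (sch N) q v ->
  j < `|q| / 2 -> v = 0.

Definition virasoro_primary (j : R) (O : V) : Prop :=
  ope X (Gam N) O [:: der X O; j%:C *: O].

Definition current_primary (q : R) (O : V) : Prop :=
  ope X (sig N) O [:: q%:C *: O].

Definition superpartner (O : V) : V := mode X (Qm N) 0 O.

Definition higgs_primary (r j q : R) (p : bool) (O : V) : Prop :=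
  [/\ homog (rch X) r O /\ homog (par X) p O,
      virasoro_primary j O /\ current_primary q O,
      ope X (Qp N) O [::],
      ope X (Qm N) O [:: superpartner O] &
      virasoro_primary (j + 1 / 2) (superpartner O) /\
      current_primary (q - 1) (superpartner O)].

Definition higgs_alg (O : V) : Prop :=
  exists s : seq (C * V),
    (forall c P, (c, P) \in s ->
       exists r j q : R, exists p : bool, higgs_primary r j q p P) /\
    O = \sum_(t <- s) t.1 *: t.2.

(* The bilinear extension, through the decomposition into parity components,
   of 1/2 (Psi_O1_(0) O2 - (-1)^(|O1||O2|) Psi_O2_(0) O1). *)
Definition higgs_bracket (O1 O2 : V) : V :=
  \sum_(p1 : bool) \sum_(p2 : bool)
    let A := par X p1 O1 in let B := par X p2 O2 in
    2^-1 *: (mode X (superpartner A) 0 B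
             - (-1) ^+ (p1 && p2) *: mode X (superpartner B) 0 A).

End Higgs.

Record lie_algebra (g : lmodType C) := LieAlgebra {
  lbr : g -> g -> g;
  lbr_linearl : forall c x y z, lbr (c *: x + y) z = c *: lbr x z + lbr y z;
  lbr_linearr : forall c x y z, lbr z (c *: x + y) = c *: lbr z x + lbr z y;
  lbr_alt : forall x, lbr x x = 0;
  lbr_jacobi : forall x y z,
    lbr x (lbr y z) + lbr y (lbr z x) + lbr z (lbr x y) = 0
}.

Definition is_basis (g : lmodType C) (I : choiceType) (T : I -> g) : Prop :=
  (forall x, exists s : seq (C * I), x = \sum_(t <- s) t.1 *: T t.2) /\
  (forall (s : seq I) (c : I -> C), uniq s ->
     \sum_(a <- s) c a *: T a = 0 -> forall a, a \in s -> c a = 0).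

Section Flavor.
Variables (S : algType C) (SG : graded_comm_alg S) (V : lmodType C).
Variables (X : raviolo_va SG V) (N : n2_superconformal X).
Variables (g : lmodType C) (L : lie_algebra g) (I : choiceType) (T : I -> g).

(* mu_a = mu (T a), and f^c_ab mu_c = mu [T_a, T_b]. *)
Record hamiltonian_symmetry (mu : {linear g -> V}) (K : I -> I -> S) : Prop :=
HamiltonianSymmetry {
  mu_charges : forall a, has_charges X 1 1 true (mu (T a));
  mu_sch : forall a, homog (sch N) 0 (mu (T a));
  ope_mumu : forall a b,
    ope X (mu (T a)) (mu (T b))
      [:: mu (lbr L (T a) (T b)); sact X (K a b) (vac X)];
  mu_primary : forall a, virasoro_primary N 1 (mu (T a))
}.

Record higgs_flavor_symmetry (mu M : {linear g -> V}) (K : I -> I -> S) : Prop :=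
HiggsFlavorSymmetry {
  hfs_hamiltonian : hamiltonian_symmetry mu K;
  hfs_primary : forall a, higgs_primary N 1 (1 / 2) 1 false (M (T a));
  hfs_superpartner : forall a, mu (T a) = superpartner N (M (T a));
  ope_QpM : forall a, ope X (Qp N) (M (T a)) [::];
  ope_QmM : forall a, ope X (Qm N) (M (T a)) [:: mu (T a)];
  ope_Qpmu : forall a,
    ope X (Qp N) (mu (T a)) [:: der X (M (T a)); M (T a)];
  ope_Qmmu : forall a, ope X (Qm N) (mu (T a)) [::]
}.

(* A Hamiltonian action of g on the Higgs branch, in terms of functions: g acts
   on A_H by derivations of the product and of the Poisson bracket, and M is a
   map of Lie algebras g -> A_H generating the action. *)
Record hamiltonian_action_on_higgs (act : g -> V -> V) (M : g -> V) : Prop :=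
HamiltonianActionOnHiggs {
  act_higgs : forall x O, higgs_alg N O -> higgs_alg N (act x O);
  act_linearl : forall c x y O, higgs_alg N O ->
    act (c *: x + y) O = c *: act x O + act y O;
  act_linearr : forall c x O P, higgs_alg N O -> higgs_alg N P ->
    act x (c *: O + P) = c *: act x O + act x P;
  act_lbr : forall x y O, higgs_alg N O ->
    act (lbr L x y) O = act x (act y O) - act y (act x O);
  act_nop : forall x O P, higgs_alg N O -> higgs_alg N P ->
    act x (nop X O P) = nop X (act x O) P + nop X O (act x P);
  act_bracket : forall x O P, higgs_alg N O -> higgs_alg N P ->
    act x (higgs_bracket N O P)
      = higgs_bracket N (act x O) P + higgs_bracket N O (act x P);
  comoment_higgs : forall x, higgs_alg N (M x);
  comoment_linear : forall c x y, M (c *: x + y) = c *: M x + M y;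
  comoment_lbr : forall x y, M (lbr L x y) = higgs_bracket N (M x) (M y);
  comoment_act : forall x O, higgs_alg N O -> act x O = higgs_bracket N (M x) O
}.

End Flavor.
End Raviolo.

(* Main.v *)
Require Import Defs.
From HB Require Import structures.
From mathcomp Require Import all_boot all_order all_algebra.
From mathcomp Require Import boolp classical_sets fsbigop reals complex.
From mathcomp Require Import zify ring lra.

(** The action of [x] is the zero mode [mu(x)_(0)]. Zero modes of odd operators
    are derivations of every product [_(n)] with [n >= 0], by the degree 2 part of
    associativity. The operator product expansions of the [mu_a] with [Gam], [sig],
    [Q+] and [Q-] make [mu_a(0)] commute with all nonnegative modes of these four
    fields; so it preserves Higgs branch primaries and their charges, commutes with
    taking superpartners and is a derivation of the Poisson bracket. Reading off
    [M_a] as [Q+_(1) mu_a] turns [mu_[a,b] = mu_a(0) mu_b] into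
    [M_[a,b] = mu_a(0) M_b].

    Two facts remain. First, [mu_a(0) O = {M_a, O}] for a Higgs branch primary [O].
    A nonzero primary has spin equal to half its [S]-charge, as it is killed by
    [Q+_(0)] and [Q-_(1)]; so by the BPS bound [O_(0) M_a = 0] and
    [mu_a(m) O = 0] for [m > 0]. Applying [Q-_(0)] to the first equation gives
    [Psi_O(0) M_a = +- O_(0) mu_a], and skew-symmetry, which has only one term by
    the second, turns this into [- mu_a(0) O].

    Second, [mu_a(0)] is a derivation of the normally ordered product, a relation
    between a nonnegative and a negative mode. This relation and skew-symmetry
    must be extracted from locality. Locality tests one vector and one functional
    at a time, and says that the commutator of the polar part of [A(z)] with the
    regular part of [B(w)] is, after pairing, killed by a power of [z - w]. Since
    a functional can be chosen not to vanish on any of countably many given nonzero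
    vectors ([functional_nonvanishing]), the power does not depend on the
    functional; by translation covariance it does not depend on [k] either when
    the commutator acts on [C_(-1-k) vac]. Set
    [h = [A(z), B(w)] C(x) vac - (polar part of sum_l Omega^l_(z-w) (A_(l) B)(w)) C(x) vac].
    It is killed by a power of [z - w]. Moving [A] to the vacuum
    ([mode_translate]) shows that [h] is, up to sign, unchanged when [(B, w)] and
    [(C, x)] are exchanged, so it is also killed by a power of [z - x]. As
    [z - w] and [z - x] differ by the nonzerodivisor [x - w], [h] vanishes
    ([nilpotent_zw_zx_eq0]), which is the commutator formula. *)

Set Implicit Arguments.
Unset Strict Implicit.
Unset Printing Implicit Defensive.

Import Order.TTheory GRing.Theory Num.Theory.

Local Open Scope classical_set_scope.
Local Open Scope complex_scope.
Local Open Scope ring_scope.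

(** * Linear functionals on spaces of arbitrary dimension *)

Section Functionals.
Variable R : realType.

Lemma sum_halves_le1 (s : seq nat) : uniq s ->
  \sum_(n <- s) (2^-1 : R) ^+ n.+1 <= 1.
Proof.
move=> us; pose K := (\max_(n <- s) n).+1.
have -> : \sum_(n <- s) (2^-1 : R) ^+ n.+1 =
    \sum_(n < K | (n : nat) \in s) 2^-1 ^+ n.+1.
  rewrite -(big_mkord (mem s) (fun n => (2^-1 : R) ^+ n.+1)) -big_filter.
  apply: perm_big; apply: uniq_perm => // [|n].
    by rewrite filter_uniq ?iota_uniq.
  rewrite mem_filter mem_index_iota /=; case: (boolP (n \in s)) => //= ns.
  by rewrite ltnS; symmetry; apply: leq_bigmax_seq.
apply: (@le_trans _ _ (\sum_(n < K) 2^-1 ^+ n.+1)).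
  rewrite [leRHS](bigID (fun n : 'I_K => (n : nat) \in s)) /= lerDl.
  by apply: sumr_ge0 => n _; rewrite exprn_ge0 ?invr_ge0.
suff -> : \sum_(n < K) (2^-1 : R) ^+ n.+1 = 1 - 2^-1 ^+ K.
  by rewrite gerBl exprn_ge0 ?invr_ge0.
elim: (K) => [|k IH]; first by rewrite big_ord0 expr0 subrr.
rewrite big_ord_recr /= IH -addrA; congr (_ + _); rewrite addrC.
by rewrite exprS {2}(splitr (2^-1 ^+ k)) opprD addrA mulrC subrr add0r.
Qed.

(** Give the real [r] the weight [2^-(i r + 1)], so that all weights of finite sets
    are at most [1], and call [t] reached if [t] is at most the weight of some
    finite set of reals below [t]. The supremum of the reached numbers has a
    weight of its own, and adding it to a close reached number overshoots. *)
Lemma real_not_countable (i : R -> nat) : ~ injective i.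
Proof.
move=> inji; pose w (r : R) : R := 2^-1 ^+ (i r).+1.
have w_gt0 r : 0 < w r by rewrite exprn_gt0 ?invr_gt0.
pose P : set R := fun t => exists s : seq R,
  [/\ uniq s, all (< t) s & t <= \sum_(r <- s) w r].
have ubP : ubound P 1.
  move=> t [s [us _ /le_trans]]; apply.
  rewrite -(big_map i xpredT (fun n => (2^-1 : R) ^+ n.+1)).
  by apply: sum_halves_le1; rewrite map_inj_uniq.
have supP : has_sup P.
  by split; [exists 0, [::]; rewrite big_nil | exists 1].
have [t [s [us /allP st ts]] supt] := sup_adherent (w_gt0 (sup P)) supP.
have tsup : t <= sup P by apply: ub_le_sup; [case: supP | exists s; split=> //; apply/allP].
have: P (t + w (sup P)).
  exists (sup P :: s); split=> /=.
  - rewrite us andbT; apply/negP => /st /=; rewrite ltNge.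
    by rewrite tsup.
  - rewrite -ltrBlDr supt /=; apply/allP => r /st /= /lt_le_trans; apply.
    by rewrite lerDl ltW.
  - by rewrite big_cons addrC lerD2l.
move/(ub_le_sup (proj2 supP)); apply/negP; rewrite -ltNge -ltrBlDr.
exact: supt.
Qed.

Variable V : lmodType R[i].

(** A maximal subspace [K] containing no [x i] has codimension 1: if [v] and [x 0]
    were independent modulo [K], the subspaces [K + <v - t x_0>] for real [t] would
    meet pairwise in [K], and each would have to contain some [x i] by maximality,
    which embeds the reals into the naturals. The functional with kernel [K] is
    the one sought. *)
Lemma functional_nonvanishing (x : nat -> V) : (forall i, x i != 0) ->
  exists phi : {scalar V}, forall i, phi (x i) != 0.
Proof.
move=> x_neq0.
pose P (K : set V) := (forall c u v, K u -> K v -> K (c *: u + v)) /\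
  forall i, ~ K (x i).
(* Closure under [c u + v] allows the empty set, the union of the empty chain. *)
have [F FP totF|K [[Klin Kx] Kmax]] := @Zorn_bigcup V P.
  split=> [c u v [A FA Au] [B FB Bv]|i [A /FP[_ Ax] /Ax]] //.
  have [AB|BA] := totF _ _ FA FB.
    by exists B => //; apply: (proj1 (FP _ FB)) => //; apply: AB.
  by exists A => //; apply: (proj1 (FP _ FA)) => //; apply: BA.
have K0 : K 0.
  apply: contrapT => nK0.
  have Ke u : ~ K u by move=> Ku; apply: nK0; rewrite -(addNr u) -scaleN1r; apply: Klin.
  apply: (Kmax [set 0]); last first.
    split=> [c u v -> ->|i]; first by rewrite scaler0 addr0.
    by move/eqP; apply/negP/x_neq0.
  by split=> [u /Ke|/(_ 0 erefl)].
have KZ c u : K u -> K (c *: u) by move=> Ku; rewrite -[_ *: _]addr0; apply: Klin.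
have KB u v : K u -> K v -> K (u - v).
  by move=> Ku Kv; rewrite addrC -scaleN1r; apply: Klin.
have KZV c u : c != 0 -> K (c *: u) -> K u.
  by move=> c0 /(KZ c^-1); rewrite scalerA mulVf // scale1r.
have codim1 v : exists t, K (v - t *: x 0%N).
  apply: contrapT => /forallNP nKv.
  have hit (t : R) : exists ik : nat * R[i], K (x ik.1 - ik.2 *: (v - t%:C *: x 0%N)).
    apply: contrapT => /forallNP nhit.
    apply: (Kmax [set u | exists c, K (u - c *: (v - t%:C *: x 0%N))]); last first.
      split=> [c u u' [d Kd] [d' Kd']|i [c Kc]]; last by apply: (nhit (i, c)).
      exists (c * d + d'); set e := (v - _).
      by rewrite scalerDl opprD addrACA -scalerA -scalerBr; apply: Klin.
    split=> [u Ku|sub]; first by exists 0; rewrite scale0r subr0.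
    by apply: (nKv t%:C); apply: sub; exists 1; rewrite scale1r subrr.
  have [ik ikP] := choice hit.
  apply: (@real_not_countable (fun t => (ik t).1)) => t t' /= eqi.
  apply: contrapT => /eqP tt'.
  have := ikP t; have := ikP t'; rewrite -eqi; move: (ik t).1 (ik t).2 (ik t').2 => i c c'.
  (* Two values of [t] with the same [i] put a combination of [v] and [x 0] in [K]. *)
  move=> K' K1; have := KB _ _ K' K1; rewrite opprB addrC subrKA.
  rewrite !scalerBr !scalerA opprD addrACA -scalerBl opprK.
  rewrite (addrC (- _)) -scalerBl.
  have [cc'|cc'] := eqVneq c c'; last first.
    rewrite -[_ *: x _]opprK -scaleNr opprB => Kv.
    apply: (nKv ((c - c')^-1 * (c * t%:C - c' * t'%:C))%R).
    apply: (KZV (c - c')%R); first by rewrite subr_eq0.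
    by rewrite scalerBr !scalerA mulrA mulfV ?subr_eq0 // mul1r.
  rewrite -cc' subrr scale0r add0r -mulrBr => /KZV Kx0.
  apply: (Kx 0%N); apply: Kx0; rewrite mulf_neq0 //.
    apply/eqP => c0; move: K1; rewrite c0 scale0r subr0; exact: Kx.
  rewrite subr_eq0; apply/eqP => /complexI tt2.
  by rewrite tt2 eqxx in tt'.
have uniq_coef t t' : K (t *: x 0%N - t' *: x 0%N) -> t = t'.
  rewrite -scalerBl => Kt; apply/eqP; rewrite -subr_eq0; apply/negPn/negP => tt'.
  by apply: (Kx 0%N); apply: KZV Kt.
have [f fP] := choice codim1.
have flin : scalar f.
  move=> c u v; apply: uniq_coef.
  have /(KB _ _ (Klin c _ _ (fP u) (fP v))) := fP (c *: u + v).
  rewrite opprB scalerBr [X in X + _]addrACA -opprD scalerA -scalerDl.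
  by rewrite [X in K X]addrC subrKA.
pose L := GRing.isLinear.Build _ _ _ _ f flin.
pose phi : {scalar V} := HB.pack f L.
exists phi => i /=; apply/eqP => fi0; apply: (Kx i).
by have := fP (x i); rewrite /phi /= in fi0 *; rewrite fi0 scale0r subr0.
Qed.
End Functionals.

(** * Arrays killed by powers of z - w *)

Section ShiftOperators.
Variable V : zmodType.

(** Multiplication by [z - w] of the array whose entry at [m], [n] is the
    coefficient of [Omega^m_z w^n]: [z] lowers [m], and [w] raises [n]. *)
Definition sub_zw (f : nat -> nat -> V) : nat -> nat -> V := fun m n =>
  f m.+1 n - (if n is n'.+1 then f m n' else 0).

Definition sub_zw3 (h : nat -> nat -> nat -> V) : nat -> nat -> nat -> V :=
  fun m n k => sub_zw (fun m n => h m n k) m n.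

Definition swap3 (h : nat -> nat -> nat -> V) : nat -> nat -> nat -> V :=
  fun m n k => h m k n.

(** Multiplication by [z - x], for a third variable [x] indexed by [k]. *)
Definition sub_zx3 (h : nat -> nat -> nat -> V) : nat -> nat -> nat -> V :=
  swap3 (sub_zw3 (swap3 h)).

Lemma iter_sub_zw3 N h m n k :
  iter N sub_zw3 h m n k = iter N sub_zw (fun m n => h m n k) m n.
Proof.
elim: N m n => //= N IH m n; rewrite {1}/sub_zw3 /sub_zw IH.
by case: n => [|n]; rewrite // IH.
Qed.

Lemma iter_sub_zx3 N h : iter N sub_zx3 h = swap3 (iter N sub_zw3 (swap3 h)).
Proof. by elim: N => //= N ->. Qed.

Lemma sub_zw_zx3C h : sub_zw3 (sub_zx3 h) = sub_zx3 (sub_zw3 h).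
Proof.
apply/funext => m; apply/funext => n; apply/funext => k.
rewrite /sub_zx3 /sub_zw3 /swap3 /sub_zw.
case: n k => [|n] [|k]; rewrite ?subr0 //.
by rewrite !opprB addrACA [RHS]addrACA; congr (_ + _); rewrite addrC.
Qed.

(** The difference [x - w] of the two multiplications kills [h] as well. So the
    entries at [n], [k + 1] and at [n + 1], [k] agree, and those at [n = 0] vanish. *)
Lemma sub_zw_zx_eq0 h : sub_zw3 h = (fun _ _ _ => 0) ->
  sub_zx3 h = (fun _ _ _ => 0) -> h = (fun _ _ _ => 0).
Proof.
move=> hw hx.
have w m n k : h m.+1 n k = if n is n'.+1 then h m n' k else 0.
  by apply/eqP; rewrite -subr_eq0; apply/eqP; apply: (congr1 (fun f => f m n k) hw).
have x m n k : h m.+1 n k = if k is k'.+1 then h m n k' else 0.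
  by apply/eqP; rewrite -subr_eq0; apply/eqP; apply: (congr1 (fun f => f m n k) hx).
apply/funext => m; apply/funext => n; apply/funext => k.
elim: n k => [|n IH] k; first by rewrite -(x m 0%N k.+1) w.
by rewrite -(IH k.+1) -(x m n.+1 k.+1) w.
Qed.

(** The two multiplications commute, so that peeling off one factor at a time
    reduces to exponents 1. *)
Lemma nilpotent_zw_zx_eq0 N M h : iter N sub_zw3 h = (fun _ _ _ => 0) ->
  iter M sub_zx3 h = (fun _ _ _ => 0) -> h = (fun _ _ _ => 0).
Proof.
have zw0 : sub_zw3 (fun _ _ _ => 0) = (fun _ _ _ => 0).
  apply/funext => m; apply/funext => n; apply/funext => k.
  by rewrite /sub_zw3 /sub_zw; case: n => [|n]; rewrite subr0.
have zx0 : sub_zx3 (fun _ _ _ => 0) = (fun _ _ _ => 0) by rewrite /sub_zx3 zw0.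
have zwC n f : sub_zw3 (iter n sub_zx3 f) = iter n sub_zx3 (sub_zw3 f).
  by elim: n => //= n <-; rewrite sub_zw_zx3C.
have zxC n f : sub_zx3 (iter n sub_zw3 f) = iter n sub_zw3 (sub_zx3 f).
  by elim: n => //= n <-; rewrite sub_zw_zx3C.
elim: N M h => // N IHN; elim=> // M IHM h hN hM; apply: sub_zw_zx_eq0.
  by apply: (IHN M.+1); rewrite -?iterSr // -zwC hM.
by apply: IHM; rewrite -?iterSr // -zxC hN.
Qed.

End ShiftOperators.

Section LinearShift.
Variables (V W : zmodType).

Lemma iter_sub_zw_additive (phi : {additive V -> W}) N f m n :
  iter N (@sub_zw W) (fun m n => phi (f m n)) m n = phi (iter N (@sub_zw V) f m n).
Proof.
elim: N m n => //= N IH m n; rewrite /sub_zw IH raddfB.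
by case: n => [|n]; rewrite ?raddf0 ?IH.
Qed.

Lemma iter_sub_zwD N (f g : nat -> nat -> V) m n :
  iter N (@sub_zw V) (fun m n => f m n + g m n) m n =
  iter N (@sub_zw V) f m n + iter N (@sub_zw V) g m n.
Proof.
elim: N m n => //= N IH m n; rewrite /sub_zw IH.
by case: n => [|n]; rewrite ?subr0 ?IH ?opprD // addrACA.
Qed.

Lemma iter_sub_zw_eq0W N M (f : nat -> nat -> V) : (N <= M)%N ->
  (forall m n, iter N (@sub_zw V) f m n = 0) ->
  forall m n, iter M (@sub_zw V) f m n = 0.
Proof.
move=> /subnK <-; elim: (M - N)%N => //= k IH fN m n.
by rewrite /sub_zw (IH fN); case: n => [|n]; rewrite ?(IH fN) subr0.
Qed.

End LinearShift.

(** If every power of [z - w] left some nonzero vector, a functional that does not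
    vanish on any of these vectors would violate the assumption. *)
Lemma uniform_nilpotency (R : realType) (V : lmodType R[i]) (f : nat -> nat -> V) :
  (forall phi : {scalar V}, exists N, forall m n,
     iter N (@sub_zw R[i]) (fun m n => phi (f m n)) m n = 0) ->
  exists N, forall m n, iter N (@sub_zw V) f m n = 0.
Proof.
move=> nil; apply: contrapT => /forallNP fN.
have nz N : exists mn : nat * nat, iter N (@sub_zw V) f mn.1 mn.2 != 0.
  apply: contrapT => /forallNP h; apply: (fN N) => m n; apply/eqP/negPn/negP.
  exact: (h (m, n)).
have [mn mnP] := choice nz.
have [phi phiP] := functional_nonvanishing mnP.
have [N] := nil phi => /(_ (mn N).1 (mn N).2); rewrite iter_sub_zw_additive.
by apply/eqP/phiP.
Qed.

Lemma functional_separates (R : realType) (V : lmodType R[i]) (u v : V) :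
  (forall phi : {scalar V}, phi u = phi v) -> u = v.
Proof.
move=> uv; apply/eqP; rewrite -subr_eq0; apply/negPn/negP => ne.
have [phi /(_ 0%N)] := @functional_nonvanishing R V (fun=> u - v) (fun=> ne).
by rewrite raddfB /= uv subrr eqxx.
Qed.

(** * The two expansions of an element of K_{z,w,z-w} *)

Section Words.
Variable R : realType.
Local Notation C := R[i].

(** The cohomological degree, which [dmul] adds; words of length at least 2 thus
    do not contribute to the entries considered below. *)
Definition of_degree (d : nat) (f : dser R) : Prop :=
  forall p q, (odd_mode p + odd_mode q)%N != d -> f p q = 0.

Lemma fsum_setTE (f : int * int -> C) (r : seq (int * int)) : uniq r ->
  (forall ij, ij \notin r -> f ij = 0) ->
  \sum_(ij \in [set: int * int]) f ij = \sum_(ij <- r) f ij.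
Proof.
move=> ur fr; rewrite (fsbigE r) // => [|ij _]; last exact: fr.
by apply: eq_bigl => ij; rewrite in_setT.
Qed.

Lemma mode_mul_odd i j : mode_mul_neq0 i j ->
  odd_mode (i + j + 1) = (odd_mode i + odd_mode j)%N :> nat.
Proof.
rewrite /mode_mul_neq0 /odd_mode.
by case: (lerP 0 i); case: (lerP 0 j) => //= ? ?; lia.
Qed.

Lemma dmul_degree d e f g : of_degree d f -> of_degree e g ->
  of_degree (d + e) (dmul f g).
Proof.
move=> df eg p q pq; apply: fsbig1 => -[i j] _ /=.
case: ifP => // /andP[/andP[nij oij] /andP[nij' oij']].
have [dij|/df->] := eqVneq (odd_mode i + odd_mode j)%N d; last by rewrite mul0r mulr0.
rewrite eg ?mulr0 //; apply: contraNneq pq => <-; rewrite -dij; apply/eqP.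
have ep : i + (p - 1 - i) + 1 = p by lia.
have eq : j + (q - 1 - j) + 1 = q by lia.
have := @mode_mul_odd i (p - 1 - i); have := @mode_mul_odd j (q - 1 - j).
rewrite ep eq /mode_mul_neq0 nij oij nij' oij' => -> // -> //.
by rewrite addnACA.
Qed.

Lemma dser1_degree : of_degree 0 (dser1 R).
Proof.
by move=> [k|k] [l|l] //=; case: k l => [|k] [|l].
Qed.

Lemma pser_degree (a : nat -> nat -> C) : of_degree 0 (pser a).
Proof. by move=> [k|k] [l|l]. Qed.

Lemma gen_zw_degree x m : of_degree 1 (@gen_zw R x m).
Proof.
case: x => p q; rewrite /gen_zw /odd_mode; last by case: p q => [k|k] [l|l].
- by case: (eqVneq p m%:Z) => [->|]; case: (eqVneq q (-1)) => [->|].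
- by case: (eqVneq q m%:Z) => [->|]; case: (eqVneq p (-1)) => [->|].
Qed.

Lemma gen_wz_degree x m : of_degree 1 (@gen_wz R x m).
Proof.
case: x => p q; rewrite /gen_wz /odd_mode; last by case: p q => [k|k] [l|l].
- by case: (eqVneq p m%:Z) => [->|]; case: (eqVneq q (-1)) => [->|].
- by case: (eqVneq q m%:Z) => [->|]; case: (eqVneq p (-1)) => [->|].
Qed.

Lemma word_degree (gen : Defs.point -> nat -> dser R) (a : nat -> nat -> C) w :
  (forall x m, of_degree 1 (gen x m)) ->
  of_degree (size w)
    (dmul (pser a) (foldr (fun g f => dmul (gen g.1 g.2) f) (dser1 R) w)).
Proof.
move=> gen1; rewrite -[size w]add0n; apply: dmul_degree; first exact: pser_degree.
elim: w => [|[x m] w IH] /=; first exact: dser1_degree.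
by rewrite -add1n; apply: dmul_degree.
Qed.

Lemma dmul_dser1 f : dmul f (dser1 R) = f.
Proof.
apply/funext => p; apply/funext => q; rewrite /dmul.
rewrite (@fsum_setTE _ [:: (p, q)]) //=; last first.
  move=> [i j]; rewrite inE => ij; case: ifP => // _.
  suff -> : dser1 R (p - 1 - i) (q - 1 - j) = 0 by rewrite !mulr0.
  have [e|ne] := eqVneq (dser1 R (p - 1 - i) (q - 1 - j)) 0; first by [].
  case/negP: ij; move: ne; rewrite /dser1 /pser.
  case e1: (p - 1 - i) => [k|k]; rewrite ?eqxx //.
  case e2: (q - 1 - j) => [l|l]; rewrite ?eqxx //.
  case: k l e1 e2 => [|k] [|l] e1 e2; rewrite ?eqxx // => _.
  by rewrite xpair_eqE; apply/andP; split; apply/eqP; lia.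
have N1 (i : int) : i - 1 - i = -1 by lia.
rewrite big_seq1 /= !N1.
have m1 i : mode_mul_neq0 i (-1).
  by rewrite /mode_mul_neq0 /odd_mode andbF orbF /=; apply/implyP; lia.
by rewrite !m1 /= andbF mul1r mulr1.
Qed.

(** The coefficient of [Omega^m_z w^n] in [a(z, w) Omega^l_{z-w}], expanded in
    C<<z>><<w>>. *)
Definition zw_coef (a : nat -> nat -> C) (l m n : nat) : C :=
  \sum_(t < n.+1)
    (if (m + t <= l + n)%N then a (l + n - t - m)%N t else 0) * 'C(l + n - t, l)%:R.

Lemma dmul_pser_zw a l (m n : nat) :
  dmul (pser a) (gen_zw R Pzw l) m (Negz n) = zw_coef a l m n.
Proof.
pose r := [seq (Negz (l + n - t - m), Negz t) | t <- iota 0 n.+1].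
have ur : uniq r by rewrite map_inj_uniq ?iota_uniq // => t t' [].
rewrite /dmul (fsum_setTE ur); last first.
  move=> [[i|i] [j|j]] /=; try by rewrite !(mul0r, mulr0) if_same.
  move=> nin; case: ifP => // /andP[h1 h2].
  have -> : Posz m - 1 - Negz i = Posz (m + i) by lia.
  have [jn|nj] := leqP j n; last first.
    by case e : (Negz n - 1 - Negz j) => [k|k] /=; [rewrite !mulr0 | lia].
  have -> : Negz n - 1 - Negz j = Negz (n - j) by lia.
  rewrite /=; case: eqP => [e|]; last by rewrite !mulr0.
  case/negP: nin; apply/mapP; exists j; first by rewrite mem_iota; lia.
  by congr (Negz _, _); lia.
rewrite /zw_coef big_map -[n.+1 in RHS]subn0 -(big_mkord xpredT
  (fun t => (if (m + t <= l + n)%N then a (l + n - t - m)%N t else 0) * 'C(l + n - t, l)%:R)).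
rewrite /index_iota subn0; apply: eq_big_seq => t; rewrite mem_iota /= => tn.
have e2 : Negz n - 1 - Negz t = Negz (n - t) by lia.
rewrite e2; have [le|lt] := leqP (m + t) (l + n); last first.
  rewrite mul0r; case e : (Posz m - 1 - Negz (l + n - t - m)) => [k|k] //=; last lia.
  by case: eqP => [?|]; [lia | rewrite !mulr0 if_same].
have -> : Posz m - 1 - Negz (l + n - t - m) = Posz (l + (n - t)) by lia.
rewrite /= eqxx mul1r /mode_mul_neq0 /odd_mode /=.
rewrite (_ : 0 <= Negz (l + n - t - m) + Posz (l + (n - t)) + 1 = true); last by lia.
rewrite (_ : (l + n - t = l + (n - t))%N); last lia.
by rewrite -(bin_sub (leq_addl l (n - t))) addnK.
Qed.

(** This is [(z - w) Omega^(l+1)_{z-w} = Omega^l_{z-w}]. *)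
Lemma sub_zw_zw_coefS a l : sub_zw (zw_coef a l.+1) = zw_coef a l.
Proof.
apply/funext => m; apply/funext => n; rewrite /sub_zw /zw_coef.
rewrite big_ord_recr [RHS]big_ord_recr /= !addnK !binn.
rewrite addrAC; congr (_ + _).
case: n => [|n]; first by rewrite !big_ord0 subrr.
rewrite -sumrB; apply: eq_bigr => t _.
have -> : (m.+1 + t <= l.+1 + n.+1)%N = (m + t <= l + n.+1)%N by lia.
have -> : (m + t <= l.+1 + n)%N = (m + t <= l + n.+1)%N by lia.
have -> : (l.+1 + n.+1 - t - m.+1)%N = (l + n.+1 - t - m)%N by lia.
have -> : (l.+1 + n - t - m)%N = (l + n.+1 - t - m)%N by lia.
rewrite -mulrBr; congr (_ * _).
have -> : (l.+1 + n.+1 - t = (l + n.+1 - t).+1)%N by have := ltn_ord t; lia.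
by rewrite binS addnC natrD addSnnS addrK.
Qed.

Lemma sub_zw_zw_coef0 a : sub_zw (zw_coef a 0) = fun _ _ => 0.
Proof.
apply/funext => m; apply/funext => n; rewrite /sub_zw /zw_coef.
rewrite big_ord_recr /= !add0n ifN ?mul0r ?addr0; last lia.
case: n => [|n]; first by rewrite big_ord0 subrr.
rewrite -sumrB big1 // => t _; rewrite !bin0.
have -> : (m.+1 + t <= n.+1)%N = (m + t <= n)%N by lia.
have -> : (n.+1 - t - m.+1)%N = (n - t - m)%N by lia.
by rewrite subrr.
Qed.

Lemma zw_coef_nilpotent a l : iter l.+1 (@sub_zw C) (zw_coef a l) = fun _ _ => 0.
Proof.
elim: l => [|l IH]; first exact: sub_zw_zw_coef0.
by rewrite iterSr sub_zw_zw_coefS.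
Qed.

(** In degree 1 the generators [Omega_z] and [Omega_w] have equal expansions, so
    that only the words [Omega^l_{z-w}] contribute to the difference. *)
Definition word_coef (t : (nat -> nat -> C) * seq (Defs.point * nat)) : nat -> nat -> C :=
  if t.2 is [:: (Pzw, l)] then zw_coef t.1 l else fun _ _ => 0.

Lemma expand_zw_sub_wz (E : Kzw R) (m n : nat) :
  expand_zw E m (Negz n) - expand_wz E m (Negz n) = \sum_(t <- E) word_coef t m n.
Proof.
rewrite /expand_zw /expand_wz /expand -sumrB; apply: eq_bigr => -[a w] _ /=.
rewrite /word_coef /=; case: w => [|[x l] w] /=; first by rewrite dmul_dser1 subrr.
case: w => [|g w]; last first.
  rewrite [X in X - _](@word_degree (@gen_zw R) a [:: (x, l), g & w] gen_zw_degree) //.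
  rewrite [X in _ - X](@word_degree (@gen_wz R) a [:: (x, l), g & w] gen_wz_degree) //.
  by rewrite subrr; case: x.
rewrite /= !dmul_dser1; case: x; rewrite ?subrr // dmul_pser_zw.
rewrite [X in _ - X]fsbig1 ?subr0 // => -[[i|i] [j|j]] _ /=; rewrite ?(mul0r, mulr0, if_same) //.
have -> : Posz m - 1 - Negz i = Posz (m + i) by lia.
by case: (_ - Negz j) => k; rewrite ?(mul0r, mulr0, if_same).
Qed.

Lemma word_coef_nilpotent (E : Kzw R) : exists N, forall m n,
  iter N (@sub_zw C) (fun m n => \sum_(t <- E) word_coef t m n) m n = 0.
Proof.
elim: E => [|[a w] E [N IH]].
  by exists 0%N => m n /=; rewrite big_nil.
have [M HM] : exists M, forall m n, iter M (@sub_zw C) (word_coef (a, w)) m n = 0.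
  rewrite /word_coef; case: w => [|[[] l] [|g w]]; try by exists 0%N.
  by exists l.+1 => m n; rewrite zw_coef_nilpotent.
exists (maxn M N) => m n.
rewrite (_ : (fun m n => _) =
    (fun m n => word_coef (a, w) m n + \sum_(t <- E) word_coef t m n)); last first.
  by apply/funext => m'; apply/funext => n'; rewrite big_cons.
rewrite iter_sub_zwD (iter_sub_zw_eq0W (leq_maxl M N) HM).
by rewrite (iter_sub_zw_eq0W (leq_maxr M N) IH) addr0.
Qed.

Lemma expand_difference_nilpotent (E : Kzw R) : exists N, forall m n,
  iter N (@sub_zw C)
    (fun m n => expand_zw E m (Negz n) - expand_wz E m (Negz n)) m n = 0.
Proof.
have [N HN] := word_coef_nilpotent E; exists N => m n; rewrite -[RHS](HN m n).
congr (iter N _ _ m n); apply/funext => m'; apply/funext => n'.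
exact: expand_zw_sub_wz.
Qed.

(** In degree 0 only power series contribute, and they have one expansion. *)
Lemma expand_even (E : Kzw R) (k l : nat) :
  expand_zw E (Negz k) (Negz l) = expand_wz E (Negz k) (Negz l).
Proof.
apply: eq_bigr => -[a w] _ /=; case: w => // g w.
rewrite (@word_degree (@gen_zw R) a (g :: w) gen_zw_degree) //.
by rewrite (@word_degree (@gen_wz R) a (g :: w) gen_wz_degree).
Qed.

(** The coefficient of [Omega^0_w] in [a(z, w) Omega^l_{z-w}], expanded in
    C<<w>><<z>>. *)
Definition word_residue (t : (nat -> nat -> C) * seq (Defs.point * nat)) : C :=
  if t.2 is [:: (Pzw, l)] then (-1) ^+ l * t.1 0%N l else 0.

Lemma expand_wz_sub_zw (E : Kzw R) :
  expand_wz E (-1) 0 - expand_zw E (-1) 0 = \sum_(t <- E) word_residue t.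
Proof.
rewrite /expand_zw /expand_wz /expand -sumrB; apply: eq_bigr => -[a w] _ /=.
rewrite /word_residue /=; case: w => [|[x l] w] /=; first by rewrite dmul_dser1 subrr.
case: w => [|g w]; last first.
  rewrite [X in X - _](@word_degree (@gen_wz R) a [:: (x, l), g & w] gen_wz_degree) //.
  rewrite [X in _ - X](@word_degree (@gen_zw R) a [:: (x, l), g & w] gen_zw_degree) //.
  by rewrite subrr; case: x.
rewrite /= !dmul_dser1; case: x; rewrite ?subrr //.
rewrite [X in _ - X]fsbig1 ?subr0; last first.
  move=> [[i|i] [j|j]] _ /=; rewrite ?(mul0r, mulr0, if_same) //.
  have -> : (0 : int) - 1 - Negz j = Posz j by lia.
  by case: (_ - Negz i) => k; rewrite ?(mul0r, mulr0, if_same).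
rewrite /dmul (@fsum_setTE _ [:: (Negz 0, Negz l)]) //; last first.
  move=> [[i|i] [j|j]] /=; rewrite ?(mul0r, mulr0, if_same) // => nin.
  have -> : (0 : int) - 1 - Negz j = Posz j by lia.
  case e : (-1 - 1 - Negz i) => [k|k] /=; rewrite ?(mul0r, mulr0, if_same) //.
  case: eqP => [ejk|_]; rewrite ?(mul0r, mulr0, if_same) //.
  case: i e nin => [|i] e nin; last by exfalso; lia.
  by case/negP: nin; rewrite inE; apply/eqP; congr (_, Negz _); lia.
rewrite big_seq1 /=.
have -> : (0 : int) - 1 - Negz l = Posz l by lia.
have -> : (l.+1 - (0 - 0).+1 = l)%N by lia.
have -> : (l + ((0 + 0).+1 - 1) = l)%N by lia.
rewrite eqxx expr0 mul1r (_ : ((0 + 0).+1 - 1 = 0)%N) // bin0 mulr1 mulrC.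
rewrite /mode_mul_neq0 /odd_mode /=.
by rewrite (_ : 0 <= Negz l + Posz l + 1 = true) //; lia.
Qed.

Lemma prod_natr_ffact (n l : nat) :
  \prod_(i < l) (n%:R - i%:R) = (n ^_ l)%:R :> C.
Proof.
elim: l => [|l IH]; first by rewrite big_ord0 ffactn0.
rewrite big_ord_recr /= IH ffactnSr natrM.
have [ln|nl] := leqP l n; first by rewrite natrB.
by rewrite ffact_small // !mul0r.
Qed.

(** The binomial coefficient of ['X + c] over [l], as a polynomial in ['X]. *)
Definition bin_poly (l : nat) (c : C) : {poly C} :=
  (l`!%:R)^-1 *: \prod_(i < l) ('X + (c - i%:R)%:P).

Lemma bin_polyE l c x : (bin_poly l c).[x] = (l`!%:R)^-1 * \prod_(i < l) (x + c - i%:R).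
Proof.
rewrite /bin_poly hornerZ horner_prod; congr (_ * _); apply: eq_bigr => i _.
by rewrite hornerD hornerX hornerC addrA.
Qed.

Lemma fact_neq0 l : (l`!%:R : C) != 0.
Proof. by rewrite pnatr_eq0 -lt0n fact_gt0. Qed.

Lemma bin_poly_nat l c x n : x + c = n%:R -> (bin_poly l c).[x] = 'C(n, l)%:R.
Proof.
move=> xc; rewrite bin_polyE xc prod_natr_ffact; apply: (mulfI (fact_neq0 l)).
by rewrite mulrA mulfV ?fact_neq0 // mul1r -natrM mulnC bin_ffact.
Qed.

Lemma bin_polyN1 l c x : x + c = -1 -> (bin_poly l c).[x] = (-1) ^+ l.
Proof.
move=> xc; rewrite bin_polyE xc; apply: (mulfI (fact_neq0 l)).
rewrite mulrA mulfV ?fact_neq0 // mul1r.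
elim: l => [|l IH]; first by rewrite big_ord0 fact0 mul1r.
rewrite big_ord_recr /= IH factS natrM exprS -opprD -[1 + _]/(1%:R + l%:R) -natrD add1n.
by rewrite mulrN mulN1r mulrN mulrC mulrA.
Qed.

Lemma poly_const_on_nat (P : {poly C}) k :
  (forall m : nat, P.[m%:R] = k) -> P = k%:P.
Proof.
move=> Pk; apply/eqP; rewrite -subr_eq0; apply/eqP.
apply: (@roots_geq_poly_eq0 _ _ [seq m%:R | m <- iota 0 (size (P - k%:P)%R)]).
- by apply/allP => _ /mapP[m _ ->]; rewrite rootE hornerD hornerN hornerC Pk subrr.
- by rewrite map_inj_uniq ?iota_uniq // => m m' /eqP; rewrite eqr_nat => /eqP.
- by rewrite size_map size_iota.
Qed.

(** Along the diagonal [m = n] the coefficients in C<<z>><<w>> are polynomial in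
    [m]; the value of this polynomial at [m = -1] is the coefficient in
    C<<w>><<z>>. This is the shadow of the fact that both expansions come from one
    rational function, and it is what makes skew-symmetry follow from locality. *)
Definition word_poly (t : (nat -> nat -> C) * seq (Defs.point * nat)) : {poly C} :=
  if t.2 is [:: (Pzw, l)] then
    \sum_(s < l.+1) t.1 (l - s)%N s *: bin_poly l (l%:R - s%:R)
  else 0.

Lemma word_poly_nat t m : (word_poly t).[m%:R] = word_coef t m m.
Proof.
case: t => a w; rewrite /word_poly /word_coef /=.
case: w => [|[[] l] [|g w]]; rewrite ?horner0 //.
rewrite horner_sum /zw_coef.
(* The two sums have different ranges, but their terms vanish beyond [minn l m]. *)
pose F s : C := (if (s <= l)%N then a (l - s)%N s else 0) * 'C(l + m - s, l)%:R.
have F0 s : (m < s)%N || (l < s)%N -> F s = 0.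
  rewrite /F => ms; case: leqP => [sl|]; last by rewrite mul0r.
  by rewrite bin_small ?mulr0 //; lia.
have widen k : (minn l m <= k)%N -> \sum_(s < k.+1) F s = \sum_(s < (l + m).+1) F s.
  move=> lk.
  transitivity (\sum_(s < (minn l m).+1) F s); last first.
    rewrite (big_ord_widen (l + m).+1 F); last by lia.
    rewrite big_mkcond; apply: eq_bigr => s _; case: ltnP => // h.
    by rewrite F0 //; lia.
  rewrite [RHS](big_ord_widen k.+1 F); last by lia.
  rewrite [RHS]big_mkcond; apply: eq_bigr => s _; case: ltnP => // h.
  by rewrite F0 //; lia.
transitivity (\sum_(s < l.+1) F s).
  apply: eq_bigr => s _; rewrite hornerZ /F -ltnS ltn_ord; congr (_ * _).
  apply: bin_poly_nat; rewrite addrA -natrD -natrB 1?addnC //.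
  by have := ltn_ord s; lia.
rewrite widen ?geq_minl // -(widen m) ?geq_minr //.
apply: eq_bigr => s _; rewrite /F.
have -> : (m + s <= l + m)%N = (s <= l)%N by lia.
by have -> : (l + m - s - m = l - s)%N by lia.
Qed.

Lemma word_polyN1 t : (word_poly t).[-1] = word_residue t.
Proof.
case: t => a w; rewrite /word_poly /word_residue /=.
case: w => [|[[] l] [|g w]]; rewrite ?horner0 //.
rewrite horner_sum big_ord_recr /= big1 ?add0r; last first.
  move=> s _; rewrite hornerZ (@bin_poly_nat _ _ _ (l - s).-1).
    by rewrite bin_small ?mulr0 //; have := ltn_ord s; lia.
  rewrite -natrB; last by rewrite ltnW.
  case E : (l - s)%N => [|k]; first by have := ltn_ord s; lia.
  by rewrite -natr1 /= addrC addrK.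
by rewrite hornerZ subnn bin_polyN1 ?subrr ?addr0 // mulrC.
Qed.

Lemma word_residue_const (E : Kzw R) k :
  (forall m, \sum_(t <- E) word_coef t m m = k) -> \sum_(t <- E) word_residue t = k.
Proof.
move=> Ek; pose P := \sum_(t <- E) word_poly t.
have PE : P = k%:P.
  apply: poly_const_on_nat => m; rewrite -(Ek m) /P horner_sum.
  by apply: eq_bigr => t _; rewrite word_poly_nat.
transitivity P.[-1]; last by rewrite PE hornerC.
by rewrite /P horner_sum; apply: eq_bigr => t _; rewrite word_polyN1.
Qed.
End Words.

(** * Commutator formula and skew-symmetry *)

Section PolarParts.
Variables (F : fieldType) (V : lmodType F).

(** The array of [\sum_l Omega^l_{z-w} G_l(w)], expanded in powers of [w], where
    [G l i] is the coefficient of [w^i] in [G_l(w)]. *)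
Definition polar_sum (G : nat -> nat -> V) (m n : nat) : V :=
  \sum_(l < m.+1) (if (m <= n + l)%N then 'C(m, l)%:R *: G l (n + l - m)%N else 0).

Lemma sub_zw_polar_sum G : sub_zw (polar_sum G) = polar_sum (fun l => G l.+1).
Proof.
apply/funext => m; apply/funext => n; rewrite /sub_zw /polar_sum.
rewrite big_ord_recl /= bin0 scale1r addn0.
case: n => [|n].
  rewrite ltn0 add0r subr0; apply: eq_bigr => l _; rewrite !add0n ltnS subSS.
  by case: leqP => // ml; rewrite binS bin_small ?add0n.
have -> : \sum_(l < m.+1) (if (m <= n + l)%N then 'C(m, l)%:R *: G l (n + l - m)%N else 0)
   = \sum_(l < m.+2) (if (m <= n + l)%N then 'C(m, l)%:R *: G l (n + l - m)%N else 0).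
  by rewrite [RHS]big_ord_recr /= bin_small // scale0r if_same addr0.
rewrite [in X in _ - X]big_ord_recl /= bin0 scale1r addn0 ltnS subSS.
rewrite opprD addrACA subrr add0r -sumrB; apply: eq_bigr => l _.
rewrite /bump /= add1n !addnS !addSn !ltnS !subSS.
case: leqP => // _; last by rewrite subrr.
by rewrite -scalerBl binS natrD addrC addKr.
Qed.

Lemma iter_sub_zw_polar_sum N G :
  iter N (@sub_zw V) (polar_sum G) = polar_sum (fun l => G (N + l)%N).
Proof.
elim: N => // N IH; rewrite iterS IH sub_zw_polar_sum.
by congr polar_sum; apply/funext => l; rewrite addnS.
Qed.

Lemma polar_sumZ c G m n :
  polar_sum (fun l i => c *: G l i) m n = c *: polar_sum G m n.
Proof.
rewrite /polar_sum scaler_sumr; apply: eq_bigr => l _.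
by case: ifP; rewrite ?scaler0 // !scalerA mulrC.
Qed.

Lemma polar_sum0 G m n : (forall l i, G l i = 0) -> polar_sum G m n = 0.
Proof.
by move=> G0; apply: big1 => l _; rewrite G0 scaler0 if_same.
Qed.

(** The array of [-(d/dz + d/dw)] applied to that of [f]. It commutes with
    [z - w], which is why nilpotency is preserved along translates of a vector. *)
Definition translate (f : nat -> nat -> V) (m n : nat) : V :=
  (if m is m'.+1 then m%:R *: f m' n else 0) - n.+1%:R *: f m n.+1.

Lemma sub_zw_translate f : sub_zw (translate f) = translate (sub_zw f).
Proof.
apply/funext => m; apply/funext => n; rewrite /sub_zw /translate.
have AC (P p Q S T : V) : (P + p - Q) - (S - T) = (P - S) - (Q - (T + p)).
  by rewrite !opprB (AC (3*2) (1*5*(4*2*3))%AC).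
have SZ k (v : V) : k.+1%:R *: v = k%:R *: v + v by rewrite -natr1 scalerDl scale1r.
case: n => [|n]; case: m => [|m]; rewrite ?subr0 !scalerBr.
- by rewrite !sub0r opprB !scale1r.
- by rewrite (SZ m.+1) !scale1r opprB addrA.
- have := AC 0 (1%:R *: f 0 n.+1) (n.+2%:R *: f 1 n.+2) 0 (n.+1%:R *: f 0 n.+1).
  by rewrite !add0r oppr0 add0r (SZ n.+1 (f 0%N n.+1)) !scale1r => ->.
- by rewrite (SZ m.+1) (SZ n.+1 (f m.+1 n.+1)) AC.
Qed.

End PolarParts.

Lemma polar_sum_map (F : fieldType) (V W : lmodType F) (f : {linear V -> W}) G m n :
  f (polar_sum G m n) = polar_sum (fun l i => f (G l i)) m n.
Proof.
rewrite linear_sum; apply: eq_bigr => l _.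
by case: ifP; rewrite ?linear0 // linearZ.
Qed.

Section Fields.
Variables (R : realType) (S : algType R[i]) (SG : graded_comm_alg S).
Variables (V : lmodType R[i]) (X : raviolo_va SG V).
Local Notation vac := (vac X).
Local Notation der := (der X).
Local Notation md := (mode X).

Lemma modeZ O m c v : md O m (c *: v) = c *: md O m v.
Proof. exact: linearZ. Qed.

Lemma modeD O m u v : md O m (u + v) = md O m u + md O m v.
Proof. exact: linearD. Qed.

Lemma modeB O m u v : md O m (u - v) = md O m u - md O m v.
Proof. exact: linearB. Qed.

Lemma mode0 O m : md O m 0 = 0.
Proof. exact: linear0. Qed.

Lemma mode0l m v : md 0 m v = 0.
Proof. by have := mode_linear X (-1) 0 0 m v; rewrite scaler0 addr0 scaleN1r addNr. Qed.

Lemma modeZl c O m v : md (c *: O) m v = c *: md O m v.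
Proof. by have := mode_linear X c O 0 m v; rewrite mode0l !addr0. Qed.

Lemma modeDl O O' m v : md (O + O') m v = md O m v + md O' m v.
Proof. by have := mode_linear X 1 O O' m v; rewrite !scale1r. Qed.

Lemma modeNl O m v : md (- O) m v = - md O m v.
Proof. by rewrite -scaleN1r modeZl scaleN1r. Qed.

Lemma derZ c v : der (c *: v) = c *: der v.
Proof. exact: linearZ. Qed.

Lemma derB u v : der (u - v) = der u - der v.
Proof. exact: linearB. Qed.

Lemma mode_derr O (m : int) v :
  md O m (der v) = der (md O m v) + m%:~R *: md O (m - 1) v.
Proof. by rewrite -[X in _ + X]opprK -(mode_der X) subKr. Qed.

Lemma mode_derr_nat O (m : nat) v :
  md O m (der v) = der (md O m v) + (if m is m'.+1 then m%:R *: md O m' v else 0).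
Proof.
rewrite mode_derr; case: m => [|m]; first by rewrite scale0r.
by rewrite (_ : Posz m.+1 - 1 = m) //; lia.
Qed.

Lemma mode_derr_neg O (n : nat) v :
  md O (Negz n) (der v) = der (md O (Negz n) v) - n.+1%:R *: md O (Negz n.+1) v.
Proof.
rewrite mode_derr (_ : Negz n - 1 = Negz n.+1); last lia.
by rewrite NegzE mulrNz scaleNr.
Qed.

Lemma der_mode_vac O (n : nat) :
  der (md O (Negz n) vac) = n.+1%:R *: md O (Negz n.+1) vac.
Proof.
by apply/eqP; rewrite -subr_eq0 -mode_derr_neg der_vac linear0.
Qed.

Lemma mode_vac_neg1 O : md O (Negz 0) vac = O.
Proof. exact: mode_vacN1. Qed.

Lemma scale_natS_inj n (u v : V) : n.+1%:R *: u = n.+1%:R *: v -> u = v.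
Proof. by apply: scalerI; rewrite pnatr_eq0. Qed.

(** The degree 0 part of locality. *)
Lemma negative_modes_commute p1 p2 O1 O2 k l v :
  homog (par X) p1 O1 -> homog (par X) p2 O2 ->
  md O1 (Negz k) (md O2 (Negz l) v)
    = (-1) ^+ (p1 && p2) *: md O2 (Negz l) (md O1 (Negz k) v).
Proof.
move=> h1 h2; apply: functional_separates => phi.
have [E [zw wz]] := locality v phi h1 h2.
have := expand_even E k l; rewrite zw wz /= mul1r addbF => ->.
by rewrite linearZ.
Qed.

(** The sign is governed by the parity [p1 + 1] of the mode [O1_(m)]. *)
Definition commutator (p1 p2 : bool) O1 O2 v (m n : nat) : V :=
  md O1 m (md O2 (Negz n) v)
    - (-1) ^+ (~~ p1 && p2) *: md O2 (Negz n) (md O1 m v).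

Lemma commutatorZ p1 p2 O1 O2 c v m n :
  commutator p1 p2 O1 O2 (c *: v) m n = c *: commutator p1 p2 O1 O2 v m n.
Proof.
by rewrite /commutator !modeZ scalerBr !scalerA mulrC.
Qed.

Lemma commutator_der p1 p2 O1 O2 v m n :
  commutator p1 p2 O1 O2 (der v) m n =
    der (commutator p1 p2 O1 O2 v m n) + translate (commutator p1 p2 O1 O2 v) m n.
Proof.
have AC (P p Q U W T : V) : (P + p - Q) - (U - W + T) = (P - U) + ((p - T) - (Q - W)).
  by rewrite !opprD !opprK (AC (3*3) ((1*4)*((2*6)*(3*5)))%AC).
rewrite /commutator /translate mode_derr_neg mode_derr_nat.
set s : R[i] := _ ^+ _.
rewrite modeB modeD mode_derr_nat modeZ mode_derr_neg derB derZ.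
case: m => [|m]; rewrite ?mode0 ?modeZ !scalerDr !scalerN AC; do 2 congr (_ + _);
  by rewrite ?scaler0 ?subr0 // !scalerA (mulrC s).
Qed.

Lemma commutator_nilpotent p1 p2 O1 O2 v :
  homog (par X) p1 O1 -> homog (par X) p2 O2 ->
  exists N, forall m n, iter N (@sub_zw V) (commutator p1 p2 O1 O2 v) m n = 0.
Proof.
move=> h1 h2; apply: uniform_nilpotency => phi.
have [E [zw wz]] := locality v phi h1 h2.
have [N HN] := expand_difference_nilpotent E; exists N => m n; rewrite -[RHS](HN m n).
congr (iter N _ _ m n); apply/funext => m'; apply/funext => n'.
rewrite zw wz /commutator linearB linearZ /= mul1r; congr (_ - _ * _).
by case: (p1) (p2) => [] [].
Qed.

(** The exponent is uniform in [k], because [O3_(-1-k) vac] is proportional to the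
    [k]-th translate of [O3]. *)
Lemma commutator_nilpotent_orbit p1 p2 O1 O2 O3 :
  homog (par X) p1 O1 -> homog (par X) p2 O2 ->
  exists N, forall k m n,
    iter N (@sub_zw V) (commutator p1 p2 O1 O2 (md O3 (Negz k) vac)) m n = 0.
Proof.
move=> h1 h2; have [N HN] := commutator_nilpotent (md O3 (Negz 0) vac) h1 h2.
exists N; elim=> // k IH m n; apply: (@scale_natS_inj k); rewrite scaler0.
rewrite -(iter_sub_zw_additive (GRing.scale k.+1%:R)) /=.
transitivity (iter N (@sub_zw V) (fun m n =>
    der (commutator p1 p2 O1 O2 (md O3 (Negz k) vac) m n) +
    translate (commutator p1 p2 O1 O2 (md O3 (Negz k) vac)) m n) m n).
  congr (iter N _ _ m n); apply/funext => m'; apply/funext => n'.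
  by rewrite -commutatorZ -der_mode_vac commutator_der.
rewrite iter_sub_zwD iter_sub_zw_additive IH raddf0 add0r.
have -> f : iter N (@sub_zw V) (translate f) = translate (iter N (@sub_zw V) f).
  by elim: N {HN IH} => //= N ->; rewrite sub_zw_translate.
by rewrite /translate !IH scaler0 subr0; case: m => [|m] //; rewrite IH scaler0.
Qed.

Definition product_field (O1 O2 : V) (v : V) : nat -> nat -> V :=
  fun l i => md (md O1 l O2) (Negz i) v.

(** The commutator formula on the vacuum, where [O1_(m)] vanishes. Both sides
    obey the same recursion in [n], by translation covariance. *)
Lemma mode_translate O1 O2 m n :
  md O1 (Posz m) (md O2 (Negz n) vac) = polar_sum (product_field O1 O2 vac) m n.
Proof.
elim: n m => [|n IH] m.
  rewrite mode_vac_neg1 /polar_sum big_ord_recr /= add0n leqnn subnn binn scale1r.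
  rewrite /product_field mode_vac_neg1 big1 ?add0r // => l _.
  by rewrite add0n leqNgt ltn_ord.
apply: (@scale_natS_inj n); rewrite -modeZ -der_mode_vac mode_derr_nat IH.
have dG l i : der (product_field O1 O2 vac l i)
    = i.+1%:R *: product_field O1 O2 vac l i.+1 by apply: der_mode_vac.
move: (product_field _ _ _) dG IH => G dG IH.
have -> : (if m is m'.+1 then m%:R *: md O1 m' (md O2 (Negz n) vac) else 0)
    = \sum_(l < m.+1) (if (m <= n.+1 + l)%N then
        ((m - l) * 'C(m, l))%:R *: G l (n.+1 + l - m)%N else 0).
  case: m => [|m]; first by rewrite big_ord1 /= sub0n mul0n scale0r.
  rewrite IH big_ord_recr /= subnn mul0n scale0r if_same addr0 scaler_sumr.
  apply: eq_bigr => l _; rewrite addSn ltnS subSS; case: ifP; rewrite ?scaler0 // => _.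
  by rewrite scalerA -natrM -mul_bin_down.
rewrite /polar_sum scaler_sumr linear_sum -big_split; apply: eq_bigr => l _ /=.
rewrite addSn; have lm := ltn_ord l.
have [h|h] := leqP m (n + l).
  rewrite (leq_trans h) // linearZ /= dG !scalerA -!natrM subSn // -scalerDl -natrD.
  by rewrite mulnC -mulnDl; congr ((_ * _)%:R *: _); lia.
rewrite linear0 add0r; case: ifP => // h2; rewrite ?scaler0 //.
by rewrite scalerA -natrM; congr ((_ * _)%:R *: _); lia.
Qed.

(** The array that has to vanish for the commutator formula, acting on
    [O3(x) vac]. *)
Definition commutator_defect p1 p2 O1 O2 O3 (m n k : nat) : V :=
  let v := md O3 (Negz k) vac in
  commutator p1 p2 O1 O2 v m n - polar_sum (product_field O1 O2 v) m n.

Lemma commutator_defect_nilpotent p1 p2 O1 O2 O3 :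
  homog (par X) p1 O1 -> homog (par X) p2 O2 ->
  exists N, iter N (@sub_zw3 V) (commutator_defect p1 p2 O1 O2 O3) = (fun _ _ _ => 0).
Proof.
move=> h1 h2; have [N HN] := commutator_nilpotent_orbit O3 h1 h2.
have [M HM] := mode_field X O1 O2; exists (maxn N M).
apply/funext => m; apply/funext => n; apply/funext => k; rewrite iter_sub_zw3.
rewrite /commutator_defect; set v := md O3 _ _.
rewrite (iter_sub_zwD (maxn N M) (commutator p1 p2 O1 O2 v)
  (fun m n => - polar_sum (product_field O1 O2 v) m n)).
rewrite (iter_sub_zw_eq0W (leq_maxl N M) (HN k)) add0r.
rewrite (iter_sub_zw_additive (@GRing.opp V)) iter_sub_zw_polar_sum.
rewrite polar_sum0 => [|l i]; first by rewrite /= oppr0.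
rewrite /product_field HM; last by rewrite (leq_trans (leq_maxr N M)) ?leq_addr.
exact: mode0l.
Qed.

(** The defect has three terms: [O1 O2 O3 vac], which is symmetric as negative
    modes commute, [O2 (O1 O3) vac] and [(O1 O2) O3 vac], where products of fields
    denote polar sums. The last two are exchanged, by [mode_translate] and again the
    commutation of negative modes. *)
Lemma commutator_defect_swap p1 p2 p3 O1 O2 O3 m n k :
  homog (par X) p1 O1 -> homog (par X) p2 O2 -> homog (par X) p3 O3 ->
  commutator_defect p1 p2 O1 O2 O3 m n k =
  (-1) ^+ (p2 && p3) *: commutator_defect p1 p3 O1 O3 O2 m k n.
Proof.
move=> h1 h2 h3; rewrite /commutator_defect /commutator.
have psum p p' O O' O'' i j : homog (par X) p O' -> homog (par X) p' O'' ->
   homog (par X) p1 O ->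
   polar_sum (product_field O O' (md O'' (Negz j) vac)) m i =
   (-1) ^+ ((~~ p1 (+) p) && p') *: md O'' (Negz j) (md O m (md O' (Negz i) vac)).
  move=> hp hp' hO; rewrite mode_translate polar_sum_map -polar_sumZ.
  apply: eq_bigr => l _; case: ifP => // _; congr (_ *: _).
  rewrite /product_field (@negative_modes_commute (~~ p1 (+) p) p') //.
  by have := mode_par (Posz l) hO hp; rewrite /= addbT.
rewrite (psum p2 p3) // (psum p3 p2) //.
rewrite (negative_modes_commute _ _ _ h2 h3) modeZ.
rewrite !scalerBr !scalerA -!signr_addb.
rewrite addrAC; congr (_ - _ - _); congr (_ ^+ _ *: _).
  by case: (p1) (p2) (p3) => [] [] [].
by case: (p1) (p2) (p3) => [] [] [].
Qed.

Theorem commutator_formula p1 p2 p3 O1 O2 O3 m n :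
  homog (par X) p1 O1 -> homog (par X) p2 O2 -> homog (par X) p3 O3 ->
  commutator p1 p2 O1 O2 O3 m n = polar_sum (product_field O1 O2 O3) m n.
Proof.
move=> h1 h2 h3.
have [N HN] := commutator_defect_nilpotent O3 h1 h2.
have [M HM] := commutator_defect_nilpotent O2 h1 h3.
have D0 : commutator_defect p1 p2 O1 O2 O3 = (fun _ _ _ => 0).
  apply: (nilpotent_zw_zx_eq0 HN (M := M)).
  rewrite iter_sub_zx3.
  have -> : swap3 (commutator_defect p1 p2 O1 O2 O3) = fun m k n =>
      (-1) ^+ (p2 && p3) *: commutator_defect p1 p3 O1 O3 O2 m k n.
    apply/funext => m'; apply/funext => k; apply/funext => n'.
    exact: commutator_defect_swap.
  apply/funext => m'; apply/funext => n'; apply/funext => k.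
  rewrite /swap3 iter_sub_zw3 (iter_sub_zw_additive (GRing.scale _)) /=.
  by rewrite -iter_sub_zw3 HM scaler0.
apply/eqP; rewrite -subr_eq0; apply/eqP.
have := congr1 (fun h => h m n 0%N) D0.
by rewrite /commutator_defect mode_vac_neg1.
Qed.

(** Locality on the vacuum: the diagonal coefficients in C<<z>><<w>> are constantly
    [O1_(0) O2], hence so is the polynomial interpolating them, and its value at
    [-1] is [O2_(0) O1] up to sign. *)
Theorem skew_symmetry0 p1 p2 O1 O2 :
  homog (par X) p1 O1 -> homog (par X) p2 O2 ->
  (forall m : nat, (0 < m)%N -> md O1 m O2 = 0) ->
  md O2 0 O1 = (-1) ^+ (p1 && p2) *: md O1 0 O2.
Proof.
move=> h1 h2 O12; apply: functional_separates => phi.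
have [E [zw wz]] := locality vac phi h1 h2.
have Ek m : \sum_(t <- E) word_coef t m m = phi (md O1 0 O2).
  rewrite -expand_zw_sub_wz zw wz mode_vac_ge0 mode0 linear0 mulr0 subr0 mul1r.
  congr (phi _); rewrite mode_translate /polar_sum big_ord_recl /=.
  rewrite addn0 leqnn subnn bin0 scale1r {1}/product_field mode_vac_neg1.
  rewrite big1 ?addr0 // => l _.
  by rewrite /product_field O12 // mode0l scaler0 if_same.
have := word_residue_const Ek; rewrite -expand_wz_sub_zw zw wz.
rewrite mode_vac_ge0 mode0 linear0 mulr0 subr0 mode_vacN1 linearZ /= => <-.
by rewrite addbF mulrA -signr_addb addbb mul1r.
Qed.

End Fields.

(** * Gradings and zero modes of odd operators *)

Section Gradings.
Variables (F : fieldType) (I : eqType) (V : lmodType F) (G : grading I V).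

Lemma homog_gproj i v : homog G i (G i v).
Proof. by rewrite /homog gproj_orth eqxx. Qed.

Lemma gproj_homog i k v : homog G i v -> G k v = if k == i then v else 0.
Proof. by rewrite /homog => <-; rewrite gproj_orth; case: eqP => // ->. Qed.

(** Spin and [S]-charge of a primary are prescribed as eigenvalues; this turns them
    into degrees. *)
Lemma homog_eigen (f : {linear V -> V}) (c : I -> F) i v : injective c ->
  (forall k u, homog G k u -> f u = c k *: u) -> f v = c i *: v -> homog G i v.
Proof.
move=> injc fc fv; have [s us es] := gproj_sum G v.
have G0 k : k != i -> k \in s -> G k v = 0.
  move=> ki ks; have : \sum_(j <- s) (c j - c i) *: G j v = 0.
    transitivity (f v - c i *: v); last by rewrite fv subrr.
    rewrite [in f v]es [in X in _ - X]es linear_sum scaler_sumr -sumrB.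
    by apply: eq_bigr => j _; rewrite scalerBl (fc j) //; apply: homog_gproj.
  move/(congr1 (G k)); rewrite linear0 linear_sum (bigD1_seq k) //= linearZ /=.
  rewrite homog_gproj big1 ?addr0 => [/eqP|j jk].
    by rewrite scaler_eq0 subr_eq0 (inj_eq injc) (negbTE ki) => /eqP.
  by rewrite linearZ /= gproj_orth eq_sym (negbTE jk) scaler0.
have [si|si] := boolP (i \in s).
  rewrite /homog [RHS]es (bigD1_seq i) //= big_seq_cond big1 ?addr0 // => j /andP[js ji].
  exact: G0.
suff -> : v = 0 by rewrite /homog linear0.
rewrite es big_seq big1 // => j js; apply: G0 => //.
by apply: contraNneq si => <-.
Qed.

End Gradings.

Lemma parity_sum (F : fieldType) (V : lmodType F) (G : grading bool V) v :
  v = \sum_(p : bool) G p v.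
Proof.
have [s us es] := gproj_sum G v.
rewrite [LHS]es big_uniq //= big_mkcond; apply: eq_bigr => p _.
case: ifP => // ps; rewrite es linear_sum big1_seq // => j /= js.
by rewrite gproj_orth; case: eqP => // e; rewrite e js in ps.
Qed.

Section Modes.
Variables (R : realType) (S : algType R[i]) (SG : graded_comm_alg S).
Variables (V : lmodType R[i]) (X : raviolo_va SG V).
Local Notation md := (mode X).

Lemma odd_mode0_derivation p A O (n : nat) v :
  homog (par X) true A -> homog (par X) p O ->
  md A 0 (md O n v) = md (md A 0 O) n v + md O n (md A 0 v).
Proof.
move=> hA hO; have := mode_jacobi 0 n v hA hO.
rewrite /= scale1r big_ord1 /= scale1r add0n subn0 scale1r => <-.
by rewrite subrK.
Qed.

Lemma gproj_par_odd_mode0 p A v : homog (par X) true A ->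
  par X p (md A 0 v) = md A 0 (par X p v).
Proof.
move=> hA; have h b : homog (par X) b (md A 0 (par X b v)).
  by have := mode_par 0 hA (homog_gproj (par X) b v).
rewrite {1}(parity_sum (par X) v) !linear_sum /= (bigD1 p) //= h.
rewrite big1 ?addr0 // => b bp; rewrite (gproj_homog p (h b)).
by rewrite eq_sym (negbTE bp).
Qed.

End Modes.

(** * Higgs branch primaries and the BPS bound *)

Section Superconformal.
Variables (R : realType) (S : algType R[i]) (SG : graded_comm_alg S).
Variables (V : lmodType R[i]) (X : raviolo_va SG V) (N : n2_superconformal X).
Local Notation md := (mode X).
Local Notation der := (der X).
Local Notation Gam := (Gam N).
Local Notation sig := (sig N).
Local Notation Qp := (Qp N).
Local Notation Qm := (Qm N).

Let Gam_par : homog (par X) true Gam. Proof. by case: (Gam_charges N). Qed.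
Let sig_par : homog (par X) true sig. Proof. by case: (sig_charges N). Qed.
Let Qp_par : homog (par X) false Qp. Proof. by case: (Qp_charges N). Qed.
Let Qm_par : homog (par X) false Qm. Proof. by case: (Qm_charges N). Qed.

(** The derivative is the zero mode of the odd operator [Gam], hence a derivation. *)
Lemma mode_derl p O (n : nat) v : homog (par X) p O ->
  md (der O) n v = - (n%:R *: md O (n%:Z - 1) v).
Proof.
move=> hO; have := odd_mode0_derivation n v Gam_par hO.
rewrite !Gam0 => /(canLR (addrK _)) <-.
by rewrite mode_derr opprD addrA subrr sub0r.
Qed.

Lemma virasoro_primary_spin j O : virasoro_primary N j O -> homog (spin X) j O.
Proof.
move=> vO; apply: (homog_eigen (f := md Gam 1) (c := fun k => k%:C)).
- by move=> k k' [].
- by move=> k u; apply: Gam1.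
- exact: (vO 1%N).
Qed.

Lemma current_primary_charge q O : current_primary N q O -> homog (sch N) q O.
Proof.
move=> cO; apply: (homog_eigen (f := md sig 0) (c := fun k => k%:C)).
- by move=> k k' [].
- by move=> k u; apply: sig0.
- exact: (cO 0%N).
Qed.

Lemma sch_mode q q' p O (m : nat) v : homog (par X) p O ->
  homog (sch N) q O -> homog (sch N) q' v -> homog (sch N) (q + q') (md O m v).
Proof.
move=> hp hq hq'; apply: (homog_eigen (f := md sig 0) (c := fun k => k%:C)).
- by move=> k k' [].
- by move=> k u; apply: sig0.
rewrite (odd_mode0_derivation m v sig_par hp) (sig0 hq) (sig0 hq').
by rewrite modeZl modeZ -scalerDl -rmorphD.
Qed.

(** Both [Q-_(1) O] and [Q+_(0) O] vanish, so the bracket of these two modes kills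
    [O]; it acts as [j - q / 2]. *)
Lemma higgs_primary_spin_charge r j q p O : higgs_primary N r j q p O ->
  O = 0 \/ j = q / 2.
Proof.
move=> [[_ hp] [vO cO] QpO QmO _].
have := mode_jacobi 0 1 O Qp_par Qm_par.
rewrite (QmO 1%N) (QpO 0%N) /= !mode0 scaler0 subr0 big_ord1 /= bin0 scale1r.
rewrite (ope_QpQm N 0%N) /= subn0 add0n.
rewrite modeDl !modeNl modeZl (vO 1%N) (mode_derl 1 _ sig_par) scale1r.
rewrite (_ : 1%:Z - 1 = 0) // (cO 0%N) /= expr1 scaleN1r scalerN opprK opprD opprK.
rewrite scalerA -scalerBl => /esym/eqP; rewrite scaler_eq0 => /orP[|/eqP->]; last by left.
rewrite subr_eq0 => /eqP jq; right; apply: (@complexI R).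
by rewrite jq rmorphM /= fmorphV /= rmorph_nat mulrC.
Qed.

Definition has_all_charges r j q p O : Prop :=
  has_charges X r j p O /\ homog (sch N) q O.

Lemma higgs_primary_charges r j q p O : higgs_primary N r j q p O ->
  has_all_charges r j q p O.
Proof.
move=> [[hr hp] [vO cO] _ _ _]; split; last exact: current_primary_charge.
by split=> //; apply: virasoro_primary_spin.
Qed.

Lemma bps_mode_eq0 r j q p r' j' q' p' O O' (m : nat) : bps_bound N ->
  has_all_charges r j q p O -> has_all_charges r' j' q' p' O' ->
  j + j' - m%:R - 1 < (q + q') / 2 -> md O m O' = 0.
Proof.
move=> bps [[hr hj hp] hq] [[hr' hj' hp'] hq'] small.
apply: bps (mode_rch m hr hr') (mode_spin m hj hj') (sch_mode m hp hq hq') _.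
apply: (@lt_le_trans _ _ ((q + q') / 2)).
  by rewrite (_ : j' + _ = j + j' - m%:R - 1) // -pmulrn; ring.
by rewrite ler_pM2r ?invr_gt0 // ler_norm.
Qed.

(** The product has [S]-charge twice the sum of the spins, while its spin is
    less than this sum. *)
Lemma higgs_primary_regular r j q p r' j' q' p' O O' (m : nat) : bps_bound N ->
  higgs_primary N r j q p O -> higgs_primary N r' j' q' p' O' -> md O m O' = 0.
Proof.
move=> bps hO hO'.
have [->|jq] := higgs_primary_spin_charge hO; first exact: mode0l.
have [->|jq'] := higgs_primary_spin_charge hO'; first exact: mode0.
apply: (bps_mode_eq0 bps (higgs_primary_charges hO) (higgs_primary_charges hO')).
rewrite jq jq' -mulrDl.
by apply: (@le_lt_trans _ _ ((q + q') / 2 - 1)); rewrite ?gtrBl // lerD2r gerBl.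
Qed.

(** The defining formula of the bracket, with the parities as parameters so as to
    be bilinear in the operators. *)
Definition homog_bracket (p1 p2 : bool) O1 O2 : V :=
  2^-1 *: (md (superpartner N O1) 0 O2
    - (-1) ^+ (p1 && p2) *: md (superpartner N O2) 0 O1).

Lemma superpartner0 : superpartner N 0 = 0.
Proof. exact: mode0. Qed.

Lemma superpartner_lin c u v :
  superpartner N (c *: u + v) = c *: superpartner N u + superpartner N v.
Proof. exact: linearP. Qed.

Lemma homog_bracket_linl c p1 p2 u v w :
  homog_bracket p1 p2 (c *: u + v) w = c *: homog_bracket p1 p2 u w + homog_bracket p1 p2 v w.
Proof.
rewrite /homog_bracket superpartner_lin mode_linear modeD modeZ.
set e : R[i] := _ ^+ _; rewrite (scalerDr e) opprD addrACA scalerDr; congr (_ + _).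
rewrite [RHS]scalerA (mulrC c) -scalerA; congr (_ *: _).
by rewrite scalerBr !scalerA (mulrC e).
Qed.

Lemma homog_bracket_linr c p1 p2 u v w :
  homog_bracket p1 p2 w (c *: u + v) = c *: homog_bracket p1 p2 w u + homog_bracket p1 p2 w v.
Proof.
rewrite /homog_bracket superpartner_lin mode_linear modeD modeZ.
set e : R[i] := _ ^+ _; rewrite (scalerDr e) opprD addrACA scalerDr; congr (_ + _).
rewrite [RHS]scalerA (mulrC c) -scalerA; congr (_ *: _).
by rewrite scalerBr !scalerA (mulrC e).
Qed.

Lemma higgs_bracketE O1 O2 : higgs_bracket N O1 O2 =
  \sum_(p1 : bool) \sum_(p2 : bool) homog_bracket p1 p2 (par X p1 O1) (par X p2 O2).
Proof. by []. Qed.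

Lemma higgs_bracket_linl c u v w :
  higgs_bracket N (c *: u + v) w = c *: higgs_bracket N u w + higgs_bracket N v w.
Proof.
rewrite !higgs_bracketE scaler_sumr -big_split; apply: eq_bigr => p1 _ /=.
rewrite scaler_sumr -big_split; apply: eq_bigr => p2 _ /=.
by rewrite linearP homog_bracket_linl.
Qed.

Lemma higgs_bracket_linr c u v w :
  higgs_bracket N w (c *: u + v) = c *: higgs_bracket N w u + higgs_bracket N w v.
Proof.
rewrite !higgs_bracketE scaler_sumr -big_split; apply: eq_bigr => p1 _ /=.
rewrite scaler_sumr -big_split; apply: eq_bigr => p2 _ /=.
by rewrite linearP homog_bracket_linr.
Qed.

Lemma homog_bracket0l p1 p2 O : homog_bracket p1 p2 0 O = 0.
Proof. by rewrite /homog_bracket superpartner0 mode0l mode0 scaler0 subr0 scaler0. Qed.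

Lemma homog_bracket0r p1 p2 O : homog_bracket p1 p2 O 0 = 0.
Proof. by rewrite /homog_bracket superpartner0 mode0l mode0 scaler0 subr0 scaler0. Qed.

Lemma higgs_bracket_homog p1 p2 O1 O2 :
  homog (par X) p1 O1 -> homog (par X) p2 O2 ->
  higgs_bracket N O1 O2 = homog_bracket p1 p2 O1 O2.
Proof.
move=> h1 h2; rewrite higgs_bracketE (bigD1 p1) //= (bigD1 p2) //= h1 h2.
rewrite [X in _ + X + _]big1 => [|b bp]; last first.
  by rewrite (gproj_homog b h2) (negbTE bp) homog_bracket0r.
rewrite addr0 big1 ?addr0 // => a ap; rewrite big1 // => b _.
by rewrite (gproj_homog a h1) (negbTE ap) homog_bracket0l.
Qed.

Lemma higgs_bracket0l O : higgs_bracket N 0 O = 0.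
Proof.
by have := higgs_bracket_linl (-1) 0 0 O; rewrite scaler0 addr0 scaleN1r addNr.
Qed.

Lemma higgs_bracket0r O : higgs_bracket N O 0 = 0.
Proof.
by have := higgs_bracket_linr (-1) 0 0 O; rewrite scaler0 addr0 scaleN1r addNr.
Qed.

Lemma higgs_alg_ind (P : V -> Prop) : P 0 ->
  (forall c u v, P u -> P v -> P (c *: u + v)) ->
  (forall r j q p O, higgs_primary N r j q p O -> P O) ->
  forall O, higgs_alg N O -> P O.
Proof.
move=> P0 Plin Pprim O [s [sP ->]].
elim: s sP => [|[c u] s IH] sP; first by rewrite big_nil.
rewrite big_cons; apply: Plin => /=.
  have [r [j [q [p hu]]]] := sP c u (mem_head _ _); exact: Pprim hu.
by apply: IH => c' u' h; apply: (sP c'); rewrite inE h orbT.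
Qed.

Lemma higgs_alg0 : higgs_alg N 0.
Proof. by exists [::]; rewrite big_nil. Qed.

Lemma higgs_alg_lin c u v : higgs_alg N u -> higgs_alg N v -> higgs_alg N (c *: u + v).
Proof.
move=> [s [sP ->]] [t [tP ->]]; exists ([seq (c * x.1, x.2) | x <- s] ++ t); split.
  move=> d u'; rewrite mem_cat => /orP[/mapP[[e w] /sP h [_ ->]]|/tP] //.
by rewrite big_cat big_map /= scaler_sumr; congr (_ + _); apply: eq_bigr => x _; rewrite scalerA.
Qed.

Lemma higgs_alg_primary r j q p O : higgs_primary N r j q p O -> higgs_alg N O.
Proof.
move=> hO; exists [:: (1, O)]; rewrite big_seq1 scale1r; split=> // c u.
by rewrite inE => /eqP[_ ->]; exists r, j, q, p.
Qed.

End Superconformal.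

Lemma basis_ind (R : realType) (g : lmodType R[i]) (I : choiceType) (T : I -> g)
    (P : g -> Prop) : is_basis T -> P 0 ->
  (forall c x y, P x -> P y -> P (c *: x + y)) -> (forall a, P (T a)) -> forall x, P x.
Proof.
move=> [gen _] P0 Plin PT x; have [s ->] := gen x.
by elim: s => [|t s IH]; [rewrite big_nil | rewrite big_cons; apply: Plin].
Qed.

(** * The flavor symmetry *)

Section Flavor.
Variables (R : realType) (S : algType R[i]) (SG : graded_comm_alg S).
Variables (V : lmodType R[i]) (X : raviolo_va SG V) (N : n2_superconformal X).
Variables (g : lmodType R[i]) (L : lie_algebra g) (I : choiceType) (T : I -> g).
Variables (mu M : {linear g -> V}) (K : I -> I -> S).
Hypothesis hflavor : higgs_flavor_symmetry N L T mu M K.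
Local Notation md := (mode X).

Let mu_par a : homog (par X) true (mu (T a)).
Proof. by have [] := mu_charges (hfs_hamiltonian hflavor) a. Qed.

Let mu_all_charges a : has_all_charges N 1 1 0 true (mu (T a)).
Proof.
have h := hfs_hamiltonian hflavor.
by split; [apply: (mu_charges h) | apply: (mu_sch h)].
Qed.

Lemma sig_mu a (m : nat) : md (sig N) m (mu (T a)) = 0.
Proof.
have [_ _ _ _ [_]] := hfs_primary hflavor a; rewrite -(hfs_superpartner hflavor).
by rewrite subrr => /(_ m) ->; case: m => [|m] /=; rewrite ?scale0r // nth_nil.
Qed.

(** The terms [Gam_(0) mu = der mu] and [Gam_(1) mu = mu] of the commutator cancel;
    the same happens for [Q+] with [M] in place of [mu]. *)
Lemma mu0_comm_Gam a (m : nat) v :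
  md (Gam N) m (md (mu (T a)) 0 v) = md (mu (T a)) 0 (md (Gam N) m v).
Proof.
have [_ _ Gp] := Gam_charges N.
have := mode_jacobi m 0 v Gp (mu_par a).
rewrite /= !scale1r => /eqP; rewrite subr_eq => /eqP ->.
rewrite (_ : \sum_(l < _) _ = 0) ?add0r //.
have vm := mu_primary (hfs_hamiltonian hflavor) a.
case: m => [|m].
  by rewrite big_ord1 /= (vm 0%N) /= (mode_derl N _ _ (mu_par a)) scale0r oppr0 scaler0.
rewrite 2!big_ord_recl big1 /= => [|l _]; last by rewrite (vm _) /= nth_nil mode0l scaler0.
rewrite addr0 bin0 bin1 (vm 0%N) (vm 1%N) /= !scale1r !addn0 subn0 /bump /= subn1 /=.
by rewrite (mode_derl N _ _ (mu_par a)) (_ : m.+1%:Z - 1 = m) ?addNr //; lia.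
Qed.

Lemma mu0_comm_sig a (m : nat) v :
  md (sig N) m (md (mu (T a)) 0 v) = md (mu (T a)) 0 (md (sig N) m v).
Proof.
have [_ _ sp] := sig_charges N.
have := mode_jacobi m 0 v sp (mu_par a).
rewrite /= !scale1r => /eqP; rewrite subr_eq => /eqP ->.
by rewrite big1 ?add0r // => l _; rewrite sig_mu mode0l scaler0.
Qed.

Lemma mu0_comm_Qm a (m : nat) v :
  md (Qm N) m (md (mu (T a)) 0 v) = md (mu (T a)) 0 (md (Qm N) m v).
Proof.
have [_ _ Qp] := Qm_charges N.
have := mode_jacobi m 0 v Qp (mu_par a).
rewrite /= scale1r => /eqP; rewrite subr_eq => /eqP ->.
rewrite big1 ?scaler0 ?add0r // => l _.
by rewrite (ope_Qmmu hflavor) nth_nil mode0l scaler0.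
Qed.

Lemma M_par a : homog (par X) false (M (T a)).
Proof. by have [[]] := hfs_primary hflavor a. Qed.

Lemma mu0_comm_Qp a (m : nat) v :
  md (Qp N) m (md (mu (T a)) 0 v) = md (mu (T a)) 0 (md (Qp N) m v).
Proof.
have [_ _ qp] := Qp_charges N.
have := mode_jacobi m 0 v qp (mu_par a).
rewrite /= scale1r => /eqP; rewrite subr_eq => /eqP ->.
rewrite (_ : \sum_(l < _) _ = 0) ?scaler0 ?add0r //.
have vm := ope_Qpmu hflavor a.
case: m => [|m].
  by rewrite big_ord1 /= (vm 0%N) /= (mode_derl N _ _ (M_par a)) scale0r oppr0 scaler0.
rewrite 2!big_ord_recl big1 /= => [|l _]; last by rewrite (vm _) /= nth_nil mode0l scaler0.
rewrite addr0 bin0 bin1 (vm 0%N) (vm 1%N) /= !scale1r !addn0 subn0 /bump /= subn1 /=.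
by rewrite (mode_derl N _ _ (M_par a)) (_ : m.+1%:Z - 1 = m) ?addNr //; lia.
Qed.

Lemma mu0_virasoro_primary a j O : virasoro_primary N j O ->
  virasoro_primary N j (md (mu (T a)) 0 O).
Proof.
move=> vO m; rewrite mu0_comm_Gam (vO m); case: m => [|[|m]] /=.
- by rewrite -!(Gam0 N) mu0_comm_Gam.
- exact: modeZ.
- by rewrite nth_nil mode0.
Qed.

Lemma mu0_current_primary a q O : current_primary N q O ->
  current_primary N q (md (mu (T a)) 0 O).
Proof.
move=> cO m; rewrite mu0_comm_sig (cO m); case: m => [|m] /=; first exact: modeZ.
by rewrite nth_nil mode0.
Qed.

Lemma mu0_superpartner a O :
  superpartner N (md (mu (T a)) 0 O) = md (mu (T a)) 0 (superpartner N O).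
Proof. exact: mu0_comm_Qm. Qed.

Lemma mu0_higgs_primary a r j q p O : higgs_primary N r j q p O ->
  higgs_primary N r j q p (md (mu (T a)) 0 O).
Proof.
move=> [[hr hp] [vO cO] QpO QmO [vP cP]].
split.
- have [[[hr1 _ hp1] _]] := mu_all_charges a.
  split; first by have := mode_rch 0 hr1 hr; rewrite /= addrAC subrr add0r.
  by have := mode_par 0 hp1 hp.
- by split; [apply: mu0_virasoro_primary | apply: mu0_current_primary].
- by move=> m; rewrite mu0_comm_Qp (QpO m) !nth_nil mode0.
- move=> m; rewrite mu0_comm_Qm (QmO m) mu0_superpartner.
  by case: m => [|m] //=; rewrite nth_nil mode0.
- by rewrite mu0_superpartner; split; [apply: mu0_virasoro_primary | apply: mu0_current_primary].
Qed.

Lemma mu0_mode0_derivation a A v :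
  md (mu (T a)) 0 (md A 0 v) = md (md (mu (T a)) 0 A) 0 v + md A 0 (md (mu (T a)) 0 v).
Proof.
have D p B : homog (par X) p B -> md (mu (T a)) 0 (md B 0 v) =
    md (md (mu (T a)) 0 B) 0 v + md B 0 (md (mu (T a)) 0 v).
  exact: odd_mode0_derivation.
rewrite (parity_sum (par X) A) big_bool /= !modeDl !modeD !modeDl.
rewrite (D _ _ (homog_gproj (par X) true A)) (D _ _ (homog_gproj (par X) false A)).
by rewrite addrACA.
Qed.

Lemma mu0_bracket a O O' :
  md (mu (T a)) 0 (higgs_bracket N O O') =
  higgs_bracket N (md (mu (T a)) 0 O) O' + higgs_bracket N O (md (mu (T a)) 0 O').
Proof.
rewrite !higgs_bracketE linear_sum -big_split; apply: eq_bigr => p1 _ /=.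
rewrite linear_sum -big_split; apply: eq_bigr => p2 _ /=.
rewrite !gproj_par_odd_mode0 //; move: (par X p1 O) (par X p2 O') => A B.
rewrite /homog_bracket modeZ modeB modeZ !mu0_superpartner.
rewrite (mu0_mode0_derivation a (superpartner N A)) (mu0_mode0_derivation a (superpartner N B)).
set e : R[i] := _ ^+ _; rewrite -[RHS]scalerDr; congr (_ *: _).
by rewrite (scalerDr e) opprD (AC (2*2) ((1*4)*(2*3))%AC).
Qed.

Hypothesis bps : bps_bound N.

(** Applying [Q-_(0)] to [O_(0) M = 0] gives [Psi_O(0) M = +- O_(0) mu], and
    skew-symmetry identifies the right side with [- mu_(0) O]; both terms of the
    bracket thus equal [mu_(0) O / 2]. *)
Lemma mu0_eq_bracket a r j q p O : higgs_primary N r j q p O ->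
  md (mu (T a)) 0 O = higgs_bracket N (M (T a)) O.
Proof.
move=> hO; have [[hr hp] _ _ _ _] := hO; have hM := hfs_primary hflavor a.
rewrite (higgs_bracket_homog N (M_par a) hp) /homog_bracket /= expr0 scale1r.
rewrite -(hfs_superpartner hflavor).
have mu_regular (m : nat) : (0 < m)%N -> md (mu (T a)) m O = 0.
  move=> m0; have [->|jq] := higgs_primary_spin_charge hO; first exact: mode0.
  apply: (bps_mode_eq0 bps (mu_all_charges a) (higgs_primary_charges hO)).
  rewrite add0r -jq addrC addrA addrAC; have : (1 : R) <= m%:R by rewrite ler1n.
  by move=> m1; lra.
have [_ _ qp] := Qm_charges N.
have := mode_jacobi 0 0 (M (T a)) qp hp.
rewrite (higgs_primary_regular 0 bps hO hM) mode0 sub0r big_ord1 /= !scale1r.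
rewrite addn0 subn0 -/(superpartner N _) -/(superpartner N _) -(hfs_superpartner hflavor).
rewrite (skew_symmetry0 (mu_par a) hp mu_regular) /= scalerA -signr_addb addNb addbb /=.
rewrite !expr1 !scaleN1r => /oppr_inj <-.
by rewrite opprK -mulr2n -[X in _ *: X](scaler_nat 2) scalerA mulVf ?scale1r // pnatr_eq0.
Qed.

(** The commutator formula for [mu_(0)] and [O_(-1)] has only one term. *)
Lemma mu0_nop a O O' : higgs_alg N O -> higgs_alg N O' ->
  md (mu (T a)) 0 (nop X O O') = nop X (md (mu (T a)) 0 O) O' + nop X O (md (mu (T a)) 0 O').
Proof.
rewrite /nop => hO hO'; elim/higgs_alg_ind: hO => [|c u v hu hv|r j q p {}O hO].
- by rewrite !(mode0, mode0l) addr0.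
- rewrite mode_linear !modeD !modeZ !mode_linear hu hv scalerDr addrACA.
  by congr (_ + _).
elim/higgs_alg_ind: hO' => [|c u v hu hv|r' j' q' p' {}O' hO'].
- by rewrite !mode0 addr0.
- by rewrite !(modeD, modeZ) hu hv scalerDr addrACA.
have [[_ hp] _ _ _ _] := hO; have [[_ hp'] _ _ _ _] := hO'.
have := commutator_formula 0 0 (mu_par a) hp hp'.
rewrite /commutator /polar_sum big_ord1 /= expr0 !scale1r /product_field => /eqP.
by rewrite subr_eq => /eqP.
Qed.

End Flavor.

Theorem corollary3p1p4 (R : realType) (S : algType R[i])
  (SG : graded_comm_alg S) (V : lmodType R[i]) (X : raviolo_va SG V)
  (N : n2_superconformal X) (hBPS : bps_bound N)
  (g : lmodType R[i]) (L : lie_algebra g)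
  (I : choiceType) (T : I -> g) (hT : is_basis T)
  (mu M : {linear g -> V}) (K : I -> I -> S)
  (hflavor : higgs_flavor_symmetry N L T mu M K) :
  hamiltonian_action_on_higgs N L (fun x O => mode X (mu x) 0 O) M.
Proof.
have muL c x y v : mode X (mu (c *: x + y)) 0 v = c *: mode X (mu x) 0 v + mode X (mu y) 0 v.
  by rewrite linearP mode_linear.
have mu00 v : mode X (mu 0) 0 v = 0 by rewrite linear0 mode0l.
have lbr0l y : lbr L 0 y = 0.
  by have := lbr_linearl L (-1) 0 0 y; rewrite scaler0 addr0 scaleN1r addNr.
have lbr0r y : lbr L y 0 = 0.
  by have := lbr_linearr L (-1) 0 0 y; rewrite scaler0 addr0 scaleN1r addNr.
have act x O : higgs_alg N O -> mode X (mu x) 0 O = higgs_bracket N (M x) O.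
  move=> hO; move: x; apply: (basis_ind hT) => [|c x y hx hy|a].
  - by rewrite mu00 linear0 higgs_bracket0l.
  - by rewrite muL linearP higgs_bracket_linl hx hy.
  elim/higgs_alg_ind: hO => [|c u v hu hv|r j q p {}O hO].
  - by rewrite mode0 higgs_bracket0r.
  - by rewrite modeD modeZ higgs_bracket_linr hu hv.
  exact: (mu0_eq_bracket hflavor hBPS a hO).
have mumu a b : mu (lbr L (T a) (T b)) = mode X (mu (T a)) 0 (mu (T b)).
  by rewrite (ope_mumu (hfs_hamiltonian hflavor) a b 0).
(* As [mu_a(0)] commutes with [Q+_(1)], which maps [mu_b] to [M_b]. *)
have muM a b : M (lbr L (T a) (T b)) = mode X (mu (T a)) 0 (M (T b)).
  have Q1 x : mode X (Qp N) 1 (mu x) = M x.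
    move: x; apply: (basis_ind hT) => [|c x y hx hy|c]; first by rewrite !linear0.
      by rewrite !linearP hx hy.
    exact: (ope_Qpmu hflavor c 1).
  by rewrite -Q1 mumu (mu0_comm_Qp hflavor a 1) Q1.
have MH x : higgs_alg N (M x).
  move: x; apply: (basis_ind hT) => [|c x y hx hy|a].
  - by rewrite linear0; apply: higgs_alg0.
  - by rewrite linearP; apply: higgs_alg_lin.
  - exact: higgs_alg_primary (hfs_primary hflavor a).
split => //.
- move=> x O hO; move: x; apply: (basis_ind hT) => [|c x y hx hy|a].
  + by rewrite mu00; apply: higgs_alg0.
  + by rewrite muL; apply: higgs_alg_lin.
  elim/higgs_alg_ind: hO => [|c u v hu hv|r j q p {}O hO].
  + by rewrite mode0; apply: higgs_alg0.
  + by rewrite modeD modeZ; apply: higgs_alg_lin.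
  by apply: higgs_alg_primary (mu0_higgs_primary hflavor a hO).
- by move=> c x y O _; rewrite muL.
- by move=> c x O P _ _; rewrite modeD modeZ.
- move=> x y O _; move: x; apply: (basis_ind hT) => [|c x x' hx hx'|a].
  + by rewrite lbr0l !mu00 mode0 subr0.
  + rewrite lbr_linearl !muL hx hx' modeD modeZ scalerBr.
    by rewrite opprD addrACA.
  move: y; apply: (basis_ind hT) => [|c x y hx hy|b].
  + by rewrite lbr0r !mu00 mode0 subr0.
  + rewrite lbr_linearr !muL hx hy modeD modeZ scalerBr.
    by rewrite opprD addrACA.
  by rewrite mumu (mu0_mode0_derivation hflavor) addrK.
- move=> x O P hO hP; move: x; apply: (basis_ind hT) => [|c x y hx hy|a].
  + by rewrite /nop !mu00 mode0l mode0 addr0.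
  + by rewrite !muL hx hy /nop mode_linear modeD modeZ scalerDr addrACA.
  exact: (mu0_nop hflavor a hO hP).
- move=> x O P _ _; move: x; apply: (basis_ind hT) => [|c x y hx hy|a].
  + by rewrite !mu00 higgs_bracket0l higgs_bracket0r addr0.
  + by rewrite !muL hx hy higgs_bracket_linr higgs_bracket_linl scalerDr addrACA.
  exact: (mu0_bracket hflavor).
- by move=> c x y; rewrite linearP.
- move=> x y; rewrite -act //; move: x; apply: (basis_ind hT) => [|c x x' hx hx'|a].
  + by rewrite lbr0l mu00 linear0.
  + by rewrite lbr_linearl linearP muL hx hx'.
  move: y; apply: (basis_ind hT) => [|c x y hx hy|b].
  + by rewrite lbr0r linear0 mode0.
  + by rewrite lbr_linearr !linearP hx hy.
  exact: muM.
Qed.
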